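(* Let $k\ge 1$ be an integer and let $M_k=[(z-w)^k]\subset H^2(\mathbb D^2)$. Then \[ \Sigma_0(M_k)=k^2\sum_{m=k}^{\infty}\frac{1}{m^2},\qquad \Sigma_1(M_k)=\Sigma_0(M_k)-1, \] and \[ \Sigma_0(M_k)>\Sigma_1(M_k)>\Sigma_2(M_k)>\cdots, \] that is, $\Sigma_j(M_k)>\Sigma_{j+1}(M_k)$ for every $j\ge 0$. Consequently, Yang's monotonicity conjecture (that the sequence $\{\Sigma_j(M)\}_{j\ge0}$ is nonincreasing) holds in strict form for every member of the family $\{[(z-w)^k]:k\ge1\}$.
   Context: $H^2(\mathbb D^2)$ is the Hardy space over the bidisk, in which the monomials $z^aw^b$ ($a,b\ge0$) form an orthonormal basis. For a polynomial $p$, $[p]$ denotes the closure in $H^2(\mathbb D^2)$ of $p\,\mathbb C[z,w]$ (the principal submodule generated by $p$). For $M=M_k$, with $p_k=(z-w)^k$, the defect spaces $M\ominus zM$ and $M\ominus wM$ are graded by homogeneous degree. In each degree $n+k$, $n\ge0$, the homogeneous component of each defect space is one-dimensional, and there is nothing in lower degrees. Let $\{\phi_n:n\ge0\}$ and $\{\psi_n:n\ge0\}$ be homogeneous orthonormal bases of $M\ominus zM$ and $M\ominus wM$ respectively, with $\phi_n,\psi_n$ homogeneous of degree $n+k$ (each unique up to a unimodular constant). Yang's numerical invariants are \[ \Sigma_j(M)=\sum_{n=0}^\infty\left|\langle w^j\phi_n,z^j\psi_n\rangle\right|^2,\qquad j\ge0, \] which do not depend on the choice of unimodular constants. *)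

(* Defs.v *)
From HB Require Import structures.
From mathcomp Require Export all_boot all_order all_algebra.
From mathcomp Require Export complex.
From mathcomp Require Export all_classical all_reals all_analysis.

Set Implicit Arguments.
Unset Strict Implicit.
Unset Printing Implicit Defensive.

Import Order.TTheory GRing.Theory Num.Theory.
Import numFieldNormedType.Exports.
Import Normc.

Local Open Scope classical_set_scope.
Local Open Scope complex_scope.
Local Open Scope ring_scope.

(* A formal double power series f = \sum_(a, b) f (a, b) z^a w^b, given by its
   coefficients. H^2 of the bidisk is identified with the square-summable ones
   (the predicate hardy2 below). *)
Definition series2 (R : realType) : Type := nat * nat -> R[i].

Section BidiskHardySpace.
Variable R : realType.
Implicit Types (f g : series2 R) (A B M : set (series2 R)).
Implicit Types (phi psi : nat -> series2 R).

Definition normsq2 f : \bar R := \esum_(i in [set: nat * nat]) (normc (f i) ^+ 2)%:E.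

Definition hardy2 : set (series2 R) := [set f | (normsq2 f < +oo)%E].

Definition sub2 f g : series2 R := fun i => f i - g i.

(* Linear in the first argument. The double series converges absolutely on
   hardy2, so summing over squares loses nothing; R[i]^o carries the topology of
   the complex modulus. *)
Definition inner2 f g : R[i] :=
  limn (fun N => (\sum_(a < N) \sum_(b < N)
    f (a : nat, b : nat) * (g (a : nat, b : nat))^* : R[i]^o)).

Definition mulz f : series2 R :=
  fun i => if i.1 is a.+1 then f (a, i.2) else 0.

Definition mulw f : series2 R :=
  fun i => if i.2 is b.+1 then f (i.1, b) else 0.

Definition closure2 A : set (series2 R) :=
  [set f | hardy2 f /\
    forall e : R, 0 < e -> exists2 g, A g & (normsq2 (sub2 f g) < (e ^+ 2)%:E)%E].

(* C[z, w] is {poly {poly R[i]}}, with z the outer variable and w the inner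
   one, so that p`_a`_b is the coefficient of z^a w^b. *)
Definition zvar : {poly {poly R[i]}} := 'X.
Definition wvar : {poly {poly R[i]}} := 'X%:P.

Definition of_poly2 (p : {poly {poly R[i]}}) : series2 R :=
  fun i => p`_i.1`_i.2.

Definition principal_submodule (p : {poly {poly R[i]}}) : set (series2 R) :=
  closure2 [set of_poly2 (p * q) | q in [set: {poly {poly R[i]}}]].

Definition Mk (k : nat) : set (series2 R) :=
  principal_submodule ((zvar - wvar) ^+ k).

Definition ominus A B : set (series2 R) :=
  [set f | A f /\ forall g, B g -> inner2 f g = 0].

Definition defect_z M : set (series2 R) := ominus M (mulz @` M).
Definition defect_w M : set (series2 R) := ominus M (mulw @` M).

Definition homogeneous2 (d : nat) f : Prop :=
  forall a b : nat, (a + b)%N != d -> f (a, b) = 0.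

Definition orthonormal2 phi : Prop :=
  forall m n : nat, inner2 (phi m) (phi n) = (m == n)%:R.

Definition span2 phi : set (series2 R) :=
  [set g | exists (n : nat) (c : nat -> R[i]),
    g = (fun i => \sum_(m < n) c m * phi m i)].

(* An orthonormal (Hilbert space) basis of A whose n-th element is homogeneous
   of degree n + k. *)
Definition homogeneous_onb (k : nat) A phi : Prop :=
  [/\ forall n, A (phi n),
      forall n, homogeneous2 (n + k) (phi n),
      orthonormal2 phi
    & closure2 (span2 phi) = A].

(* Yang's invariant as a sum in [0, +oo]. *)
Definition Sigma phi psi (j : nat) : \bar R :=
  (\sum_(0 <= n <oo)
    (normc (inner2 (iter j mulw (phi n)) (iter j mulz (psi n))) ^+ 2)%:E)%E.

End BidiskHardySpace.
Arguments Mk : clear implicits.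

(* Main.v *)
(* Writing the monomial z^a w^(d-a) as X^a, the degree d = n + k component of
   M_k consists of the polynomials of degree <= d divisible by (1 - X)^k.  The
   generators phi_n, psi_n of the two defect spaces in that degree are, up to
   scalars, the Szego polynomials on the circle for the weight |1 - x|^(2k) and
   their reversals, with Verblunsky coefficients k / (n + k + 1).  Hence the j-th
   pairing is c_j(d), the coefficient of X^(d+j) in phi_n^2 divided by
   |phi_n|^2, up to a unimodular factor.  One finds |c_0(d)| = k / d and
   |c_1(d)| = k / (d + 1), which gives Sigma_0 and Sigma_1.

   For j >= 1 the individual terms are not monotone in j.  With
   P_j(d) = (d + j) c_j(d), N = d + 1 and
     x = P_j(d) / (N - j),      v = P_(j+1)(d) / (N + j),
     u = P_j(d+1) / (N + j),    y = P_(j+1)(d+1) / (N - j),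
   the recursions amount to
     x - y = u - v  and  (N^2 - k^2) (x - u) = N j (x + v).
   These make c_j(d)^2 - c_(j+1)(d)^2 a nonnegative quantity plus the difference
   G(d) - G(d+1) of a quadratic form G in P_j and P_(j+1), which is positive at
   the first index and tends to 0 as d grows. *)
Require Import Defs.
From mathcomp Require Import ring lra zify.
Import Order.TTheory GRing.Theory Num.Theory.
Import numFieldNormedType.Exports.
Local Open Scope classical_set_scope.
Local Open Scope ring_scope.

Set Implicit Arguments.
Unset Strict Implicit.
Unset Printing Implicit Defensive.

(** * Homogeneous extremal polynomials and their Szego recursion *)

Section Szego.
Variables (R : realFieldType) (k : nat).
Implicit Types (n s a j : nat) (p : {poly R}).

Definition verblunsky n : R := k%:R / (n + k).+1%:R.

(* The first component is phi_n normalised by phi_n(0) = 1; the second one is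
   its reversal multiplied by (-1)^k, a sign that keeps the recursion free of
   signs. *)
Fixpoint szego n : {poly R} * {poly R} :=
  if n is m.+1 then
    let: (f, g) := szego m in
    (f + (verblunsky m)%:P * ('X * g), 'X * g + (verblunsky m)%:P * f)
  else ((1 - 'X) ^+ k, (1 - 'X) ^+ k).

Definition sphi n := (szego n).1.
Definition spsi n := (szego n).2.

Lemma sphiS n : sphi n.+1 = sphi n + (verblunsky n)%:P * ('X * spsi n).
Proof. by rewrite /sphi /spsi /=; case: (szego n). Qed.

Lemma spsiS n : spsi n.+1 = 'X * spsi n + (verblunsky n)%:P * sphi n.
Proof. by rewrite /sphi /spsi /=; case: (szego n). Qed.

Lemma verblunskyM n : verblunsky n * (n + k).+1%:R = k%:R.
Proof. by rewrite /verblunsky divfK // pnatr_eq0. Qed.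

Lemma derivXsubl_exp m : (1 - 'X) * ((1 - 'X) ^+ m)^`() = - (m%:R%:P * (1 - 'X) ^+ m) :> {poly R}.
Proof.
rewrite deriv_exp derivB derivX -[1]polyC1 derivC sub0r polyC1.
case: m => [|m] /=; first by rewrite mulr0n mulr0 polyC0 mul0r oppr0.
rewrite exprS -mulr_natr polyC_natr; ring.
Qed.

(** A first-order differential system for the pair, inherited from (1 - X)^k. The Szego step
    preserves it exactly because [verblunsky n] times n + k + 1 equals k. All recursions in the
    coefficient index at fixed n are read off from it. *)
Lemma szego_deriv n :
  (1 - 'X) * (sphi n)^`() = - (k%:R%:P * spsi n) /\
  'X * (1 - 'X) * (spsi n)^`() =
    (n + k)%:R%:P * ((1 - 'X) * spsi n) - k%:R%:P * sphi n.
Proof.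
elim: n => [|n [IHf IHg]].
  split; first exact: derivXsubl_exp.
  rewrite /sphi /spsi /= add0n -mulrA derivXsubl_exp; ring.
have bE : (verblunsky n)%:P * ((n + k)%:R%:P + 1) = k%:R%:P.
  by rewrite -polyC1 -polyCD -polyCM natr1 verblunskyM.
have dE : (n.+1 + k)%:R%:P = (n + k)%:R%:P + 1 :> {poly R}.
  by rewrite -polyC1 -polyCD natr1 addSn.
rewrite sphiS spsiS !derivD !derivM !derivC derivX dE !mul0r !add0r !mul1r.
move: IHf IHg bE; move: ((sphi n)^`()) ((spsi n)^`()) => f' g'.
move: (sphi n) (spsi n) (verblunsky n)%:P k%:R%:P (n + k)%:R%:P => f g b kk d.
move: ('X : {poly R}) => x IHf IHg bE; subst kk.
split.
  rewrite [LHS](_ : _ = (1 - x) * f' + b * ((1 - x) * g + x * (1 - x) * g')).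
    rewrite IHf IHg. ring.
  ring.
rewrite [LHS](_ : _ = x * (1 - x) * g + x * (x * (1 - x) * g') + x * b * ((1 - x) * f')).
  rewrite IHf IHg; ring.
ring.
Qed.

Lemma coef_1subXM p s : ((1 - 'X) * p)`_s.+1 = p`_s.+1 - p`_s.
Proof. by rewrite mulrBl mul1r coefB coefXM. Qed.

Lemma coef_1subXM_deriv p s :
  ((1 - 'X) * p^`())`_s = s.+1%:R * p`_s.+1 - s%:R * p`_s.
Proof.
rewrite mulrBl mul1r coefB coefXM.
have E i : p^`()`_i = i.+1%:R * p`_i.+1 by rewrite coef_deriv mulr_natl.
by case: s => [|s]; rewrite !E ?mul0r.
Qed.

Lemma coef_X1subXM_deriv p s :
  ('X * (1 - 'X) * p^`())`_s.+1 = s.+1%:R * p`_s.+1 - s%:R * p`_s.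
Proof. by rewrite -mulrA coefXM coef_1subXM_deriv. Qed.

(* This is the orthogonality to the shifted submodule: the vanishing coefficients
   are k-th differences of the coefficient sequences of phi_n and psi_n. *)
Lemma szego_gap n :
  (forall s, (k < s <= n + k)%N -> ((1 - 'X) ^+ k * sphi n)`_s = 0) /\
  (forall s, (k <= s < n + k)%N -> ((1 - 'X) ^+ k * spsi n)`_s = 0).
Proof.
elim: n => [|n [IHZ IHW]]; first by split=> s; lia.
have [df dg] := szego_deriv n.
set Z := _ * sphi n in IHZ *; set W := _ * spsi n in IHW *.
have dZ : (1 - 'X) * Z^`() = - (k%:R%:P * Z) - k%:R%:P * W.
  rewrite /Z /W derivM [LHS](_ : _ = (1 - 'X) * ((1 - 'X) ^+ k)^`() * sphi n
    + (1 - 'X) ^+ k * ((1 - 'X) * (sphi n)^`())); last by ring.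
  by rewrite derivXsubl_exp df; ring.
have dW : 'X * (1 - 'X) * W^`() =
    - (k%:R%:P * ('X * W)) + (n + k)%:R%:P * ((1 - 'X) * W) - k%:R%:P * Z.
  rewrite /Z /W derivM [LHS](_ : _ = 'X * ((1 - 'X) * ((1 - 'X) ^+ k)^`()) * spsi n
    + (1 - 'X) ^+ k * ('X * (1 - 'X) * (spsi n)^`())); last by ring.
  by rewrite derivXsubl_exp dg; ring.
have eZ s : s.+1%:R * Z`_s.+1 - s%:R * Z`_s = - (k%:R * Z`_s) - k%:R * W`_s.
  by rewrite -coef_1subXM_deriv dZ coefB coefN !coefCM.
have eW s : s.+1%:R * W`_s.+1 - s%:R * W`_s =
    - (k%:R * W`_s) + (n + k)%:R * (W`_s.+1 - W`_s) - k%:R * Z`_s.+1.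
  by rewrite -coef_X1subXM_deriv dW coefB coefD coefN !coefCM coefXM coef_1subXM.
have ZS : (1 - 'X) ^+ k * sphi n.+1 = Z + (verblunsky n)%:P * ('X * W).
  by rewrite sphiS /Z /W; ring.
have WS : (1 - 'X) ^+ k * spsi n.+1 = 'X * W + (verblunsky n)%:P * Z.
  by rewrite spsiS /Z /W; ring.
have nz : (n + k).+1%:R != 0 :> R by rewrite pnatr_eq0.
(* Induction covers all but one coefficient in each half: index n + k + 1 for Z and index k for W.
   There [eZ], respectively [eW], at the edge of the gap says that the new coefficient vanishes. *)
split=> s Hs.
  rewrite ZS coefD coefCM coefXM; case: s Hs => [|s] Hs //=.
  have [sl|sE] : (s < n + k)%N \/ s = (n + k)%N by lia.
    by rewrite IHZ ?IHW ?mulr0 ?addr0 //; lia.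
  (* For n = 0 the index k lies outside the gap, but then the two factors coincide; otherwise the
     coefficient is 0. *)
  have e : (n + k)%:R * Z`_s = k%:R * Z`_s.
    case: (n) IHZ sE => [|m] IHZ sE; first by rewrite add0n.
    by rewrite IHZ ?mulr0 //; lia.
  have := eZ s; rewrite sE in e *; rewrite e => {}e.
  apply: (mulfI nz); rewrite mulr0 mulrDr mulrA [_ * verblunsky _]mulrC verblunskyM.
  by move: e => /(canRL (subrK _)) ->; ring.
rewrite WS coefD coefCM coefXM; case: s Hs => [|s] Hs /=.
  have k0 : k = 0%N by lia.
  by rewrite /verblunsky [X in X%:R / _]k0 mul0r mul0r addr0.
have [kl|sE] : (k < s.+1)%N \/ s.+1 = k by lia.
  by rewrite IHZ ?IHW ?mulr0 ?addr0 //; lia.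
have e : (n + k)%:R * W`_s.+1 = k%:R * W`_s.+1.
  case: (n) IHW => [|m] IHW; first by rewrite add0n.
  by rewrite IHW ?mulr0 //; lia.
have := eW s; rewrite mulrBr e -natr1 => {}e.
have kE : k%:R = s%:R + 1 :> R by rewrite -sE natr1.
apply: (mulfI nz); rewrite mulr0 mulrDr mulrA [_ * verblunsky _]mulrC verblunskyM.
rewrite -natr1 kE in e *.
by move/eqP: e; rewrite -subr_eq0 => /eqP e; rewrite -[RHS]e; ring.
Qed.

Lemma szego_size n :
  (size (sphi n) <= (n + k).+1)%N /\ (size (spsi n) <= (n + k).+1)%N.
Proof.
have sX p : (size ('X * p)%R <= (size p).+1)%N.
  by have [->|p0] := eqVneq p 0; rewrite ?mulr0 ?size_poly0 // mulrC size_mulX.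
elim: n => [|n [IHf IHg]].
  have s0 : (size ((1 - 'X : {poly R}) ^+ k) <= k.+1)%N.
    rewrite (leq_trans (size_poly_exp_leq _ _)) // ltnS.
    by rewrite -opprB size_polyN -polyC1 size_XsubC mul1n.
  by rewrite /sphi /spsi /=.
have sC (c : R) p m : (size p <= m)%N -> (size (c%:P * p)%R <= m)%N.
  by move=> pm; rewrite mul_polyC (leq_trans (size_scale_leq _ _)).
rewrite sphiS spsiS; split; rewrite (leq_trans (size_polyD _ _)) // geq_max addSn.
  by rewrite (leqW IHf) sC // (leq_trans (sX _)).
by rewrite (leq_trans (sX _)) // sC // (leqW IHf).
Qed.

Lemma sphi_coef_gt n a : (n + k < a)%N -> (sphi n)`_a = 0.
Proof. by move=> na; rewrite nth_default // (leq_trans (szego_size n).1). Qed.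

Lemma coef_1subX_exp m a : ((1 - 'X : {poly R}) ^+ m)`_a = (-1) ^+ a * 'C(m, a)%:R.
Proof.
elim: m a => [|m IH] a; first by rewrite expr0 coef1; case: a => [|a]; rewrite ?mulr0 ?expr0 ?mulr1.
rewrite exprS; case: a => [|a]; last first.
  by rewrite coef_1subXM !IH binS natrD exprS; ring.
by rewrite mulrBl mul1r coefB coefXM IH subr0 !bin0.
Qed.

Lemma spsi_rev n a : (a <= n + k)%N ->
  (spsi n)`_a = (-1) ^+ k * (sphi n)`_(n + k - a).
Proof.
elim: n a => [|n IH] a le_a.
  rewrite /sphi /spsi /= !coef_1subX_exp add0n -[in RHS]bin_sub; last by lia.
  rewrite subKn; last by lia.
  rewrite mulrA -exprD -signr_odd -[in RHS]signr_odd.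
  by congr ((-1) ^+ (nat_of_bool _) * _); lia.
rewrite spsiS sphiS !coefD !coefCM !coefXM.
have E : (sphi n)`_a = (-1) ^+ k *
    (if (n.+1 + k - a)%N == 0%N then 0 else (spsi n)`_(n.+1 + k - a).-1).
  have [z|z] := eqVneq (n.+1 + k - a)%N 0%N.
    by rewrite mulr0 sphi_coef_gt //; lia.
  rewrite IH; last by lia.
  by rewrite mulrA -expr2 sqrr_sign mul1r; congr (_`_ _); lia.
rewrite E; case: a le_a {E} => [|a] le_a /=.
  rewrite [in RHS](@sphi_coef_gt n (n.+1 + k - 0)) ; last by lia.
  by rewrite !add0r; ring.
rewrite IH; last by lia.
have -> : (n.+1 + k - a.+1 = n + k - a)%N by lia.
ring.
Qed.

Lemma sphi_coef0 n : (sphi n)`_0 = 1.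
Proof.
elim: n => [|n IH]; first by rewrite /sphi /= coef_1subX_exp bin0 mulr1.
by rewrite sphiS coefD coefCM coefXM mulr0 addr0.
Qed.

Lemma szego_dvd n :
  (exists q, sphi n = (1 - 'X) ^+ k * q) /\ (exists q, spsi n = (1 - 'X) ^+ k * q).
Proof.
elim: n => [|n [[p IHp] [q IHq]]]; first by split; exists 1; rewrite mulr1.
rewrite sphiS spsiS IHp IHq; split.
  by exists (p + (verblunsky n)%:P * ('X * q)); ring.
by exists ('X * q + (verblunsky n)%:P * p); ring.
Qed.

(** * Coefficients of the products phi_n^2, phi_n psi_n and psi_n^2 *)

Definition cA n s : R := (sphi n ^+ 2)`_s.
Definition cB n s : R := (sphi n * spsi n)`_s.
Definition cC n s : R := (spsi n ^+ 2)`_s.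

(** The differential system gives (1 - X) (phi^2)' = - 2 k phi psi. *)
Lemma cA_rec n s :
  s.+1%:R * cA n s.+1 - s%:R * cA n s = - (2%:R * k%:R * cB n s).
Proof.
have [df _] := szego_deriv n.
rewrite -coef_1subXM_deriv expr2 derivM.
rewrite [(1 - 'X) * _](_ : _ = - (2%:R * k%:R)%:P * (sphi n * spsi n)).
  by rewrite mulNr coefN coefCM.
rewrite [LHS](_ : _ = 2%:R * sphi n * ((1 - 'X) * (sphi n)^`())); last by ring.
by rewrite df polyCM polyC_natr; ring.
Qed.

Lemma cB_rec n s :
  s.+1%:R * cB n s.+1 - s%:R * cB n s =
    - (k%:R * cC n s) + (n + k)%:R * (cB n s.+1 - cB n s) - k%:R * cA n s.+1.
Proof.
have [df dg] := szego_deriv n.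
rewrite -coef_X1subXM_deriv derivM.
rewrite ['X * (1 - 'X) * _](_ : _ = - (k%:R%:P * ('X * spsi n ^+ 2))
   + (n + k)%:R%:P * ((1 - 'X) * (sphi n * spsi n)) - k%:R%:P * sphi n ^+ 2).
  by rewrite coefB coefD coefN !coefCM coefXM coef_1subXM.
rewrite [LHS](_ : _ = 'X * spsi n * ((1 - 'X) * (sphi n)^`())
  + sphi n * ('X * (1 - 'X) * (spsi n)^`())); last by ring.
by rewrite df dg; ring.
Qed.

(** Both 2 (n + k) psi^2 - X (psi^2)' and - (phi^2)' become 2 k phi psi after multiplication by 1 -
    X, so they agree. *)
Lemma cC_cA n s :
  (2%:R * (n + k)%:R - s%:R) * cC n s = - (s.+1%:R * cA n s.+1).
Proof.
have [df dg] := szego_deriv n.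
have n0 : 1 - 'X != 0 :> {poly R}.
  by rewrite -oppr_eq0 opprB -polyC1 polyXsubC_eq0.
have /(congr1 (fun p : {poly R} => p`_s)) :
    (2%:R * (n + k)%:R)%:P * spsi n ^+ 2 - 'X * (spsi n ^+ 2)^`() = - (sphi n ^+ 2)^`().
  apply: (mulfI n0); rewrite !expr2 !derivM polyCM polyC_natr.
  rewrite [LHS](_ : _ = 2%:R * (n + k)%:R%:P * ((1 - 'X) * spsi n ^+ 2)
    - 2%:R * spsi n * ('X * (1 - 'X) * (spsi n)^`())); last by ring.
  rewrite [RHS](_ : _ = - (2%:R * sphi n * ((1 - 'X) * (sphi n)^`()))); last by ring.
  by rewrite df dg; ring.
have E p i : p^`()`_i = i.+1%:R * p`_i.+1 by rewrite coef_deriv mulr_natl.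
rewrite coefB coefN coefCM coefXM !E -/(cA n s.+1) -/(cC n s) => <-.
by rewrite mulrBl; congr (_ - _); case: s => [|s]; rewrite ?mul0r ?E.
Qed.

Lemma cA_next n s :
  cA n.+1 s.+2 = cA n s.+2 + 2%:R * verblunsky n * cB n s.+1 + verblunsky n ^+ 2 * cC n s.
Proof.
rewrite /cA /cB /cC sphiS.
rewrite [(_ + _) ^+ 2](_ : _ = sphi n ^+ 2 + (2%:R * verblunsky n)%:P * ('X * (sphi n * spsi n))
  + (verblunsky n ^+ 2)%:P * ('X * ('X * spsi n ^+ 2))).
  by rewrite !coefD !coefCM !coefXM.
by rewrite !polyCM polyC_natr; ring.
Qed.

Definition sqnorm n : R := \sum_(a < (n + k).+1) (sphi n)`_a ^+ 2.

Lemma sqnorm_gt0 n : 0 < sqnorm n.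
Proof.
rewrite /sqnorm big_ord_recl /= sphi_coef0 expr1n ltr_pwDl //.
by apply: sumr_ge0 => i _; rewrite sqr_ge0.
Qed.

Lemma cB_top n : cB n (n + k) = (-1) ^+ k * sqnorm n.
Proof.
rewrite /cB coefM mulr_sumr; apply: eq_bigr => -[a /= lta] _.
rewrite spsi_rev; last by lia.
by rewrite subKn; [ring|lia].
Qed.

Lemma cB_top_neq0 n : cB n (n + k) != 0.
Proof. by rewrite cB_top mulf_eq0 signr_eq0 /= gt_eqF // sqnorm_gt0. Qed.

Lemma cC_top n : cC n (n + k) = cA n (n + k).
Proof.
rewrite /cC /cA !coefM [RHS](reindex_inj rev_ord_inj) /=; apply: eq_bigr => -[a /= lta] _.
rewrite subSS !spsi_rev; [|lia..].
rewrite mulrACA -expr2 sqrr_sign mul1r mulrC.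
by rewrite subKn // mulrC.
Qed.

(** At s = n + k the reversal symmetry [cC_top] lets [cC_cA] eliminate the coefficient at s + 1 from
    [cA_rec]. This is the evaluation |c_0(d)| = k / d. *)
Lemma cA_top n : (n + k)%:R * cA n (n + k) = k%:R * cB n (n + k).
Proof.
have := cC_cA n (n + k); have := cA_rec n (n + k); rewrite cC_top.
by move: (cA n _) (cA n _) (cB n _) => a b c; lra.
Qed.

(** The left side is the pairing of w^j phi_n with z^j psi_n in its only degree n + k + j. Reversing
    psi_n turns this correlation into a convolution of phi_n with itself. *)
Lemma cA_corr n j :
  \sum_(a < (n + k + j).+1) (sphi n)`_a * (if (j <= a)%N then (spsi n)`_(a - j) else 0) =
  (-1) ^+ k * cA n (n + k + j).
Proof.
rewrite /cA coefM mulr_sumr; apply: eq_bigr => -[a /= lta] _.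
case: leqP => ja; last by rewrite mulr0 (@sphi_coef_gt n (n + k + j - a)) ?mulr0 //; lia.
rewrite spsi_rev; last by lia.
have -> : (n + k - (a - j) = n + k + j - a)%N by lia.
ring.
Qed.

(** * Recursions from n to n + 1 and the normalised pairings *)

Hypothesis k_gt0 : (0 < k)%N.

Definition level n : R := (n + k).+1%:R.
Local Notation N := level.

Lemma level_gt0 n : 0 < N n. Proof. by rewrite ltr0n. Qed.

(** In [cA_next], [cA_rec] eliminates the coefficient of phi psi and [cC_cA] that of psi^2; the
    factor in [cC_cA] at this index is N n - j, hence the multiplication by it. *)
Lemma cA_nextE n j :
  N n ^+ 2 * (N n - j%:R) * cA n.+1 (n.+1 + k + j) =
  - (N n * j%:R * (N n - j%:R) * cA n (n.+1 + k + j))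
  + (N n - 1 + j%:R) * (N n * (N n - j%:R) - k%:R ^+ 2) * cA n (n + k + j).
Proof.
have [s sE] : exists s, (n + k + j = s.+1)%N by exists (n + k + j).-1; lia.
have -> : (n.+1 + k + j = s.+2)%N by lia.
rewrite sE cA_next.
have NE : N n = (n + k)%:R + 1 by rewrite /level natr1.
have s1E : s.+1%:R = N n - 1 + j%:R by rewrite NE addrK -natrD sE.
have s2E : s.+2%:R = N n + j%:R by rewrite -natr1 s1E; ring.
have sE' : s%:R = N n - 2%:R + j%:R by apply: (addIr 1); rewrite natr1 s1E; ring.
have dE : (n + k)%:R = N n - 1 by rewrite NE addrK.
have := cA_rec n s.+1; rewrite s1E s2E => H1.
have := cC_cA n s; rewrite s1E sE' dE => H3.
have bE : verblunsky n = k%:R / N n by [].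
have N0 : N n != 0 by rewrite gt_eqF // level_gt0.
have -> : N n ^+ 2 * (N n - j%:R) *
  (cA n s.+2 + 2%:R * verblunsky n * cB n s.+1 + verblunsky n ^+ 2 * cC n s)
  = (N n - j%:R) * (N n ^+ 2 * cA n s.+2 + N n * (2%:R * k%:R * cB n s.+1))
    + k%:R ^+ 2 * ((N n - j%:R) * cC n s) by rewrite bE; move: (N n) N0 => M N0; field.
have -> : (N n - j%:R) * cC n s = (2%:R * (N n - 1) - (N n - 2%:R + j%:R)) * cC n s by ring.
rewrite H3 -[2%:R * _ * cB _ _]opprK -H1; ring.
Qed.

(** The Szego norm formula: the squared norm shrinks by 1 - [verblunsky n] ^ 2. It comes from
    [cA_nextE] at j = 0, with [cA_top] applied at n and at n + 1. *)
Lemma cB_top_next n :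
  N n ^+ 2 * cB n.+1 (n.+1 + k) = (N n ^+ 2 - k%:R ^+ 2) * cB n (n + k).
Proof.
have k0 : k%:R != 0 :> R by rewrite pnatr_eq0 -lt0n.
have N0 : N n != 0 by rewrite gt_eqF // level_gt0.
have := cA_nextE n 0; rewrite !addn0 !subr0 !addr0 !mulr0 !mul0r oppr0 add0r => H.
have H1 := cA_top n; have := cA_top n.+1.
have dE : (n + k)%:R = N n - 1 by rewrite /level -natr1 addrK.
rewrite dE in H1; rewrite addSn -/(N n) => H2; rewrite addSn in H.
apply: (mulfI k0); apply: (mulfI N0).
rewrite [LHS](_ : _ = N n ^+ 2 * N n * (k%:R * cB n.+1 (n + k).+1)); last by ring.
rewrite -H2 [LHS](_ : _ = N n * (N n ^+ 2 * N n * cA n.+1 (n + k).+1)); last by ring.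
rewrite H [RHS](_ : _ = N n * (N n ^+ 2 - k%:R ^+ 2) * (k%:R * cB n (n + k))); last by ring.
by rewrite -H1; ring.
Qed.

Lemma cA_next_cross n j :
  (N n + 1 + j%:R) * (N n ^+ 2 * cA n.+1 (n.+1 + k + j.+1))
  + (N n - j%:R) * (N n ^+ 2 * cA n.+1 (n.+1 + k + j))
  = (N n ^+ 2 - k%:R ^+ 2) * ((N n - 1 + j%:R) * cA n (n + k + j)
    + (N n - j%:R) * cA n (n + k + j.+1)).
Proof.
have [s sE] : exists s, (n + k + j = s.+1)%N by exists (n + k + j).-1; lia.
have -> : (n.+1 + k + j = s.+2)%N by lia.
have -> : (n.+1 + k + j.+1 = s.+3)%N by lia.
have -> : (n + k + j.+1 = s.+2)%N by lia.
rewrite sE !cA_next.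
have NE : N n = (n + k)%:R + 1 by rewrite /level natr1.
have s1E : s.+1%:R = N n - 1 + j%:R by rewrite NE addrK -natrD sE.
have s2E : s.+2%:R = N n + j%:R by rewrite -natr1 s1E; ring.
have s3E : s.+3%:R = N n + 1 + j%:R by rewrite -natr1 s2E; ring.
have sE' : s%:R = N n - 2%:R + j%:R by apply: (addIr 1); rewrite natr1 s1E; ring.
have dE : (n + k)%:R = N n - 1 by rewrite NE addrK.
have := cA_rec n s.+1; rewrite s1E s2E => H1.
have := cA_rec n s.+2; rewrite s2E s3E => H1'.
have := cB_rec n s.+1; rewrite s1E s2E dE => H2.
have := cC_cA n s; rewrite s1E sE' dE => H3.
have := cC_cA n s.+1; rewrite s1E s2E dE => H3'.
have bE : verblunsky n = k%:R / N n by [].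
have N0 : N n != 0 by rewrite gt_eqF // level_gt0.
have E (a b c : R) : N n ^+ 2 * (a + 2%:R * verblunsky n * b + verblunsky n ^+ 2 * c) =
  N n ^+ 2 * a + 2%:R * k%:R * N n * b + k%:R ^+ 2 * c by rewrite bE; move: (N n) N0 => M N0; field.
rewrite !E; move: (cA n s.+1) (cA n s.+2) (cA n s.+3) (cB n s.+1) (cB n s.+2) (cC n s) (cC n s.+1)
  (N n) (j%:R : R) (k%:R : R) H1 H1' H2 H3 H3' => A1 A2 A3 B1 B2 C0 C1 M i q H1 H1' H2 H3 H3'.
have lc (a b c d : R) : a = b -> c = d -> a - b + (c - d) = 0.
  by move=> -> ->; rewrite !subrr addr0.
apply/eqP; rewrite -subr_eq0; apply/eqP.
(* The difference of the two sides is an explicit combination of the defects of the five recursions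
   [H1'], [H1], [H3], [H3'] and [H2]. *)
rewrite [LHS](_ : _ = M ^+ 2 * ((M + 1 + i) * A3 - (M + i) * A2 - - (2 * q * B2)) 
  + M ^+ 2 * ((M + i) * A2 - (M - 1 + i) * A1 - - (2 * q * B1)) 
  + q ^+ 2 * ((2 * (M - 1) - (M - 2 + i)) * C0 - - ((M - 1 + i) * A1))
  + - q ^+ 2 * ((2 * (M - 1) - (M - 1 + i)) * C1 - - ((M + i) * A2))
  + 2 * q * M * ((M + i) * B2 - (M - 1 + i) * B1 - (- (q * C1) + (M - 1) * (B2 - B1) - q * A2))); last by ring.
by rewrite H1 H1' H2 H3 H3' !subrr !mulr0 !addr0.
Qed.

(* Dividing by [cB n (n + k) = (-1)^k * sqnorm n] normalises both defect vectors. *)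
Definition yang n j : R := cA n (n + k + j) / cB n (n + k).
(** P_j(d) with d = n + k, up to the sign (-1)^k. The weight absorbs the index factors of [cA_rec],
    so that P_0 = k and P_1 = - k for every n. *)
Definition wyang n j : R := (n + k + j)%:R * yang n j.

Lemma yang_wyang n j : yang n j = wyang n j / (n + k + j)%:R.
Proof.
rewrite /wyang [RHS]mulrC mulrA mulVf ?mul1r // pnatr_eq0; lia.
Qed.

Lemma wyang0 n : wyang n 0 = k%:R.
Proof. by rewrite /wyang /yang !addn0 mulrA cA_top mulfK // cB_top_neq0. Qed.

Lemma wyang_rec n j :
  wyang n j.+1 = wyang n j - 2%:R * k%:R * (cB n (n + k + j) / cB n (n + k)).
Proof.
rewrite /wyang /yang addnS mulrA mulrA.
have := cA_rec n (n + k + j) => /(canRL (subrK _)) ->; ring.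
Qed.

Lemma wyang1 n : wyang n 1 = - k%:R.
Proof.
by rewrite wyang_rec addn0 divff ?cB_top_neq0 // wyang0; ring.
Qed.

Lemma wyang_gt n j : (n + k < j)%N -> wyang n j = 0.
Proof.
move=> nj; rewrite /wyang /yang /cA nth_default ?mul0r ?mulr0 //.
rewrite expr2 (leq_trans (size_polyMleq _ _)) //.
have := (szego_size n).1; lia.
Qed.

(** Index 2 (n + k) carries the square of the leading coefficient of phi_n. By reversal this
    coefficient is psi_n(0) up to sign, which is 1 for n = 0 and a Verblunsky coefficient
    otherwise. *)
Lemma wyang_top_neq0 n : wyang n (n + k) != 0.
Proof.
rewrite /wyang /yang !mulf_neq0 ?invr_eq0 ?cB_top_neq0 ?pnatr_eq0 //; first by lia.
have psi0 : (spsi n)`_0 != 0.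
  case: n => [|n]; first by rewrite /spsi /= coef_1subX_exp bin0 mulr1 oner_eq0.
  rewrite spsiS coefD coefXM coefCM sphi_coef0 add0r mulr1.
  by rewrite mulf_neq0 ?invr_eq0 ?pnatr_eq0 -?lt0n.
have phid : (sphi n)`_(n + k) != 0.
  by move: psi0; rewrite spsi_rev // subn0 mulf_eq0 signr_eq0.
have sz : size (sphi n) = (n + k).+1.
  apply/eqP; rewrite eqn_leq (szego_size n).1 /= ltnNge.
  by apply: contraNN phid => le_sz; rewrite nth_default.
have phi_neq0 : sphi n != 0 by rewrite -size_poly_gt0 sz.
have -> : cA n (n + k + (n + k)) = lead_coef (sphi n ^+ 2).
  rewrite lead_coefE expr2 size_mul // sz /cA expr2; congr (_`_ _); lia.
by rewrite lead_coef_eq0 expf_neq0.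
Qed.

(** For n = 0 both polynomials are (1 - X)^k, so [cA_rec] closes up into a two-term recursion. *)
Lemma wyang_base j : (j <= k)%N ->
  (k%:R - j%:R) * wyang 0 j + (k%:R + j%:R) * wyang 0 j.+1 = 0.
Proof.
move=> jk; have := cA_rec 0 (k + j).
rewrite /wyang /yang !add0n -!addnS.
have -> s : cB 0 s = cA 0 s by rewrite /cA /cB /sphi /spsi /= expr2.
move=> /(canRL (subrK _)) E.
rewrite [(k + j.+1)%:R * _]mulrA E natrD; ring.
Qed.

Lemma wyang_base_neq0 j : (j <= k)%N -> wyang 0 j != 0.
Proof.
elim: j => [_|j IH jk]; first by rewrite wyang0 pnatr_eq0; lia.
have := wyang_base (ltnW jk); apply: contra_eqN => /eqP ->.
by rewrite mulr0 addr0 mulf_neq0 ?IH 1?ltnW // subr_eq0 eqr_nat; lia.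
Qed.

(** [cA_nextE] divided by the squared norms; in the notation x, u, v this is (N^2 - k^2) (x - u) = N
    j (x + v). *)
Lemma wyang_next n j : (j <= n + k)%N ->
  (N n ^+ 2 - k%:R ^+ 2) * (wyang n j / (N n - j%:R) - wyang n.+1 j / (N n + j%:R)) =
  N n * j%:R * (wyang n j / (N n - j%:R) + wyang n j.+1 / (N n + j%:R)).
Proof.
move=> jd.
have s1E : (n + k + j)%:R = N n - 1 + j%:R by rewrite /level natrD -natr1 addrK.
have s2E : (n + k + j.+1)%:R = N n + j%:R by rewrite addnS -natr1 s1E; ring.
have s2E' : (n.+1 + k + j)%:R = N n + j%:R by rewrite -s2E addnS addSn.
have sj : (n.+1 + k + j = n + k + j.+1)%N by rewrite addnS addSn.
have H := cA_nextE n j; have HB := cB_top_next n.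
have B0 := cB_top_neq0 n; have B1 := cB_top_neq0 n.+1.
have N0 : N n - j%:R != 0 by rewrite /level -natrB ?pnatr_eq0; lia.
have N1 : N n + j%:R != 0 by rewrite /level -natrD pnatr_eq0.
have N2 : N n != 0 by rewrite /level pnatr_eq0.
rewrite /wyang /yang s1E s2E s2E' -sj.
move: H HB B0 B1 N0 N1 N2.
move: (cA n _) (cA n _) (cA n.+1 _) (cB n _) (cB n.+1 _) => A2 A1 A2' B B'.
move: (N n) (j%:R : R) (k%:R : R) => M i q H HB B0 B1 N0 N1 N2.
have -> : (M + i) * (A2' / B') / (M + i) = M ^+ 2 * (M - i) * A2' / ((M ^+ 2 * B') * (M - i)).
  by field; rewrite ?N0 ?N1 ?N2 ?B1.
(* Otherwise [cB_top_next] would make the squared norm of phi_(n+1) vanish. *)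
have K0 : M ^+ 2 - q ^+ 2 != 0.
  by apply: contraNneq B1 => K0; move/eqP: HB; rewrite K0 mul0r mulf_eq0 expf_eq0 (negPf N2) andbF.
by rewrite H HB; field; rewrite N0 N1 K0 B0.
Qed.

(** The relation x - y = u - v, obtained from [cA_next_cross] in the same way. *)
Lemma wyang_next_cross n j : (j <= n + k)%N ->
  wyang n j / (N n - j%:R) - wyang n.+1 j.+1 / (N n - j%:R) =
  wyang n.+1 j / (N n + j%:R) - wyang n j.+1 / (N n + j%:R).
Proof.
move=> jd.
have s1E : (n + k + j)%:R = N n - 1 + j%:R by rewrite /level natrD -natr1 addrK.
have s2E : (n + k + j.+1)%:R = N n + j%:R by rewrite addnS -natr1 s1E; ring.
have s2E' : (n.+1 + k + j)%:R = N n + j%:R by rewrite -s2E addnS addSn.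
have s3E : (n.+1 + k + j.+1)%:R = N n + 1 + j%:R by rewrite addnS -natr1 s2E'; ring.
have H := cA_next_cross n j; have HB := cB_top_next n.
have B0 := cB_top_neq0 n; have B1 := cB_top_neq0 n.+1.
have N0 : N n - j%:R != 0 by rewrite /level -natrB ?pnatr_eq0; lia.
have N1 : N n + j%:R != 0 by rewrite /level -natrD pnatr_eq0.
have N2 : N n != 0 by rewrite /level pnatr_eq0.
rewrite /wyang /yang s1E s2E s2E' s3E.
move: H HB B0 B1 N0 N1 N2.
move: (cA n _) (cA n _) (cA n.+1 _) (cA n.+1 _) (cB n _) (cB n.+1 _).
move: (N n) (j%:R : R) (k%:R : R) => M i q A1 A2 A2' A3' B B' H HB B0 B1 N0 N1 N2.
have K0 : M ^+ 2 - q ^+ 2 != 0.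
  by apply: contraNneq B1 => K0; move/eqP: HB; rewrite K0 mul0r mulf_eq0 expf_eq0 (negPf N2) andbF.
have E : (M + 1 + i) * (A3' / B') / (M - i) + (M + i) * (A2' / B') / (M + i) =
    ((M + 1 + i) * (M ^+ 2 * A3') + (M - i) * (M ^+ 2 * A2')) / ((M ^+ 2 * B') * (M - i)).
  by field; rewrite N0 N1 N2 B1.
have E' : (M - 1 + i) * (A2 / B) / (M - i) + (M + i) * (A1 / B) / (M + i) =
    (M ^+ 2 - q ^+ 2) * ((M - 1 + i) * A2 + (M - i) * A1)
      / ((M ^+ 2 - q ^+ 2) * B * (M - i)).
  by field; rewrite N0 N1 K0 B0.
by move: E; rewrite H HB -E' => {}E; lra.
Qed.

(** [cB_rec] with psi^2 eliminated through [cC_cA]. Together with [wyang_rec] it is a coupled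
    recursion in j, and the difference of reciprocals lies in [0, 1] whatever n is. *)
Lemma cB_ratio_rec n j : (j < n + k)%N ->
  j.+1%:R * (cB n (n + k + j.+1) / cB n (n + k)) =
  j%:R * (cB n (n + k + j) / cB n (n + k))
  + k%:R * wyang n j.+1 * ((n + k - j)%:R^-1 - (n + k + j.+1)%:R^-1).
Proof.
move=> jd; have H2 := cB_rec n (n + k + j); have H3 := cC_cA n (n + k + j).
have dj : (n + k - j)%:R = (n + k)%:R - j%:R :> R by rewrite natrB // ltnW.
have dj0 : (n + k)%:R - j%:R != 0 :> R by rewrite -dj pnatr_eq0; lia.
have ds : (n + k + j.+1)%:R = (n + k)%:R + j.+1%:R :> R by rewrite natrD.
have ds0 : (n + k)%:R + j.+1%:R != 0 :> R by rewrite -ds pnatr_eq0; lia.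
rewrite /wyang /yang dj ds; move: H2 H3 (cB_top_neq0 n); rewrite -!addnS ds (natrD _ _ j).
move: (cB n _) (cB n _) (cB n _) (cA n _) (cC n _) dj0 ds0 => Bd B0 B1 A C.
rewrite -natr1; move: ((n + k)%:R : R) (j%:R : R) (k%:R : R) => d i q d0 d1 H2 H3 Bn.
have CE : C = - ((d + (i + 1)) * A) / (d - i).
  by rewrite -H3; field.
have {}H2 : (i + 1) * B1 = i * B0 - q * C - q * A.
    move/eqP: H2; rewrite -subr_eq0 => /eqP H2.
  by apply/eqP; rewrite -subr_eq0; apply/eqP; rewrite -[RHS]H2; ring.
by rewrite mulrA H2 CE; field; rewrite d0 d1 Bn.
Qed.

(* The bound is uniform in n: for fixed j the coupled recursion in j has
   coefficients that stay bounded as n grows. *)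
Lemma wyang_bounded j : exists C : R, forall n, (j <= n + k)%N -> `|wyang n j| <= C.
Proof.
suff [C HC] : exists C : R, forall n, (j <= n + k)%N ->
    `|wyang n j| <= C /\ `|cB n (n + k + j) / cB n (n + k)| <= C.
  by exists C => n /HC [].
elim: j => [|j [C HC]].
  exists (k%:R + 1) => n _; rewrite wyang0 addn0 divff ?cB_top_neq0 //.
  by rewrite normr1 ger0_norm // lerDl lerDr.
have k0 : 0 <= k%:R :> R by [].
exists (C + 2%:R * k%:R * C + k%:R * (C + 2%:R * k%:R * C)) => n jn.
have [Hw Hr] := HC n (ltnW jn).
have C0 : 0 <= C := le_trans (normr_ge0 _) Hw.
have Hw1 : `|wyang n j.+1| <= C + 2%:R * k%:R * C.
  rewrite wyang_rec (le_trans (ler_normB _ _)) // lerD // normrM ger0_norm ?mulr_ge0 //.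
  by rewrite ler_wpM2l ?mulr_ge0.
split; first by rewrite (le_trans Hw1) // lerDl ?mulr_ge0 ?addr_ge0 ?mulr_ge0.
have := cB_ratio_rec jn; set r := cB n _ / _ => rE.
have Hd : `|(n + k - j)%:R^-1 - (n + k + j.+1)%:R^-1| <= 1 :> R.
  have a0 : 0 <= (n + k + j.+1)%:R^-1 :> R by rewrite invr_ge0.
  have a1 : (n + k - j)%:R^-1 <= 1 :> R.
    by rewrite invf_le1 ?ltr0n ?ler1n; lia.
  have a2 : (n + k + j.+1)%:R^-1 <= (n + k - j)%:R^-1 :> R.
    by rewrite lef_pV2 ?posrE ?ltr0n ?ler_nat; lia.
  by rewrite ler_norml; apply/andP; split; lra.
set D := C + 2%:R * k%:R * C in Hw1 *.
have j1 : 0 < j.+1%:R :> R by [].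
rewrite -(ler_pM2l j1) -{1}[j.+1%:R]ger0_norm // -normrM rE.
rewrite (le_trans (ler_normD _ _)) // normrM [X in X * _]ger0_norm //.
have D0 : 0 <= D := le_trans (normr_ge0 _) Hw1.
have kD0 : 0 <= k%:R * D by rewrite mulr_ge0.
have CD : C <= D by rewrite lerDl ?mulr_ge0.
have : j%:R * `|cB n (n + k + j) / cB n (n + k)| <= j%:R * D.
  by rewrite ler_wpM2l // (le_trans Hr).
have : `|k%:R * wyang n j.+1 * ((n + k - j)%:R^-1 - (n + k + j.+1)%:R^-1)| <= k%:R * D.
  rewrite normrM -[leRHS]mulr1 ler_pM // normrM ger0_norm //.
  by rewrite ler_wpM2l.
have : 0 <= j%:R * (k%:R * D) by rewrite mulr_ge0.
rewrite -natr1 mulrDl mul1r mulrDr; lra.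
Qed.

End Szego.

(** * Monotonicity of the shifted pairings *)

Section Weight.
Variable R : realType.

(** With m = N + 2 i this is the second difference 1/m - 2/(m+1) + 1/(m+2) of the reciprocals. The
    terms for N and for N + 1 interlace, so their sum telescopes, which yields [weight_rec]. *)
Definition wterm (N i : nat) : R :=
  2%:R / ((N + i.*2)%:R * (N + i.*2).+1%:R * (N + i.*2).+2%:R).

(* Only the recursion [weight_rec], positivity and monotonicity matter. *)
Definition weight (N : nat) : R := limn (series (wterm N)).

Let wterm_ge0 N i : 0 <= wterm N i.
Proof. by rewrite /wterm divr_ge0 ?mulr_ge0. Qed.

Let tau (N : nat) : R := N%:R^-1 - N.+1%:R^-1.

Let wtermD N i : (0 < N)%N -> wterm N i + wterm N.+1 i = tau (N + i.*2) - tau (N + i.+1.*2).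
Proof.
move=> N0; rewrite /wterm /tau doubleS !addSn !addnS.
have : (N + i.*2)%:R != 0 :> R by rewrite pnatr_eq0; lia.
set m := (N + i.*2)%N => m0.
have m1 : m.+1%:R != 0 :> R by rewrite pnatr_eq0.
have m2 : m.+2%:R != 0 :> R by rewrite pnatr_eq0.
have m3 : m.+3%:R != 0 :> R by rewrite pnatr_eq0.
have e1 : m.+1%:R = m%:R + 1 :> R by rewrite -natr1.
have e2 : m.+2%:R = m%:R + 2%:R :> R by rewrite -addn2 natrD.
have e3 : m.+3%:R = m%:R + 3%:R :> R by rewrite -addn3 natrD.
rewrite e1 e2 e3 in m1 m2 m3 *; move: (m%:R : R) m0 m1 m2 m3 => x x0 x1 x2 x3.
by field; rewrite x0 x1 x2 x3.
Qed.

Let series_wtermD N n : (0 < N)%N ->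
  series (wterm N) n + series (wterm N.+1) n = tau N - tau (N + n.*2).
Proof.
move=> N0; elim: n => [|n IH]; first by rewrite /series /= !big_geq // addn0 subrr addr0.
rewrite /series /= !big_nat_recr //= addrACA wtermD //.
by move: IH; rewrite /series /= => ->; rewrite addrA subrK.
Qed.

Let tau_ge0 N : (0 < N)%N -> 0 <= tau N.
Proof. by move=> N0; rewrite subr_ge0 lef_pV2 ?posrE ?ltr0n ?ler_nat. Qed.

Let is_cvg_wterm N : (0 < N)%N -> cvgn (series (wterm N)).
Proof.
move=> N0; apply: nondecreasing_is_cvgn.
  by apply/nondecreasing_seqP => n; rewrite /series /= big_nat_recr //= lerDl.
exists (tau N) => _ [n _ <-].
have := series_wtermD n N0; have : 0 <= series (wterm N.+1) n by apply: sumr_ge0.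
have : 0 <= tau (N + n.*2) by apply: tau_ge0; lia.
by move: (series _ _) (series _ _) (tau _) (tau _) => a b c d; lra.
Qed.

Lemma weight_rec N : (0 < N)%N -> weight N + weight N.+1 = N%:R^-1 - N.+1%:R^-1.
Proof.
move=> N0; rewrite /weight -limD; [|exact: is_cvg_wterm..].
apply: cvg_lim => //; rewrite -/(tau N).
rewrite [X in X @ _](_ : _ = fun n => tau N - tau (N + n.*2)); last first.
  by apply/funext => n; rewrite -series_wtermD.
rewrite -[X in _ --> X]subr0; apply: cvgB; first exact: cvg_cst.
apply: (squeeze_cvgr _ (cvg_cst 0) cvg_harmonic).
near=> n; rewrite tau_ge0 /=; last by lia.
rewrite (@le_trans _ _ (N + n.*2)%:R^-1) //; first by rewrite /tau gerBl.
by rewrite lef_pV2 ?posrE ?ltr0n ?ler_nat; lia.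
Unshelve. all: by end_near. Qed.

Lemma weight_ge0 N : (0 < N)%N -> 0 <= weight N.
Proof.
by move=> N0; apply: limr_ge; [exact: is_cvg_wterm|near=> n; exact: sumr_ge0].
Unshelve. all: by end_near. Qed.

Lemma weight_dec N : (0 < N)%N -> weight N.+1 <= weight N.
Proof.
move=> N0; apply: ler_lim; [exact: is_cvg_wterm..|near=> n].
apply: ler_sum => i _; rewrite /wterm ler_pM2l //.
rewrite lef_pV2 ?posrE ?mulr_gt0 ?ltr0n //; last by lia.
by rewrite -!natrM ler_nat !addSn; lia.
Unshelve. all: by end_near. Qed.

Lemma weight_gt0 N : (0 < N)%N -> 0 < weight N.
Proof.
move=> N0; have := weight_rec N0; have := weight_dec N0.
have : 0 < N%:R^-1 - N.+1%:R^-1 :> R.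
  by rewrite subr_gt0 ltf_pV2 ?posrE ?ltr0n ?ltr_nat.
by move: (weight N) (weight N.+1) (_ - _ : R) => a b c; lra.
Qed.

Lemma weight_le N M : (0 < N <= M)%N -> weight M <= weight N.
Proof.
move=> /andP[N0]; elim: M => [|M IH]; first by lia.
rewrite leq_eqVlt => /orP[/eqP <- //|NM].
by rewrite (le_trans (weight_dec _)) ?IH //; lia.
Qed.

(* Half of [1 / N + weight N], that is, the alternating sum
   [1 / N - 1 / (N + 1) + 1 / (N + 2) - ...]. *)
Definition altsum N : R := (N%:R^-1 + weight N) / 2%:R.

Lemma altsumS N : (0 < N)%N -> altsum N.+1 = (N%:R^-1 - weight N) / 2%:R.
Proof.
move=> /weight_rec H; rewrite /altsum; congr (_ / _).
move: (weight N) (weight N.+1) (N%:R^-1 : R) (N.+1%:R^-1 : R) H => a b c d; lra.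
Qed.

(** The form G at d = N - 1, for P = P_j(d) and V = P_(j+1)(d). Its first term is c_j(d)^2, so the
    difference of two consecutive values moves the comparison to c_j(d+1) against c_(j+1)(d), which
    share the denominator d + j + 1. *)
Definition energy (j N : nat) (P V : R) : R :=
  P ^+ 2 / (N.-1 + j)%:R ^+ 2 - altsum N / (2%:R * j%:R) * (P ^+ 2 + V ^+ 2)
  - (2%:R * altsum (N + j) - altsum N) / j%:R * (P * V).

(* With r = N j / (N^2 - q^2), s = x + v and m = u - v, the right-hand side is a
   sum of squares weighted by weight (N + j) and weight N - weight (N + j). *)
Lemma energy_step (j N : nat) (q x v u y : R) :
  (0 < j < N)%N -> 0 <= q < N%:R ->
  x - y = u - v -> (N%:R ^+ 2 - q ^+ 2) * (x - u) = N%:R * j%:R * (x + v) ->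
  0 <= ((N%:R - j%:R) * x / (N.-1 + j)%:R) ^+ 2 - v ^+ 2
    + energy j N.+1 ((N%:R + j%:R) * u) ((N%:R - j%:R) * y)
    - energy j N ((N%:R - j%:R) * x) ((N%:R + j%:R) * v).
Proof.
move=> /andP[j0 jN] /andP[q0 qN] Hy Hu.
have N0 : (0 < N)%N by lia.
(* The alternating sums at N + 1 and N + j + 1 are expressed through those at N and N + j, so only
   two weights remain. *)
rewrite /energy addSn altsumS // altsumS ?ltn_addr // /altsum /=.
have D0 := weight_ge0 N0; have E0 : 0 <= weight (N + j) by apply: weight_ge0; lia.
have ED : weight (N + j) <= weight N by apply: weight_le; lia.
have Nj : (N%:R - j%:R : R) != 0 by rewrite -natrB ?pnatr_eq0 ; lia.
have Nj' : (N%:R + j%:R : R) != 0 by rewrite -natrD ?pnatr_eq0 ; lia.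
have dj' : (N.-1 + j)%:R != 0 :> R by rewrite pnatr_eq0; lia.
have jr : 0 < j%:R :> R by rewrite ltr0n.
have Nr : 0 < N%:R :> R by rewrite ltr0n.
rewrite (natrD _ N j); move: (weight N) (weight (N + j)) ((N.-1 + j)%:R) D0 E0 ED dj' => D E d D0 E0 ED d0.
move: (N%:R : R) (j%:R : R) qN Nj Nj' jr Nr Hu => M i qN Mi Mi' i0 M0 Hu.
have K0 : M ^+ 2 - q ^+ 2 != 0.
  by rewrite subr_sqr mulf_neq0 // gt_eqF //; lra.
set r := M * i / (M ^+ 2 - q ^+ 2); set s := x + v; set m := u - v.
have xu : x - u = r * s by rewrite /r mulrAC -Hu; field.
have rD : (1 - r) * s = s - (x - u) by rewrite xu; ring.
have rD' : (1 + r) * s = s + (x - u) by rewrite xu; ring.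
have ue : u = ((1 - r) * s + m) / 2%:R by rewrite rD /m /s; field.
have ve : v = ((1 - r) * s - m) / 2%:R by rewrite rD /m /s; field.
have xe : x = ((1 + r) * s + m) / 2%:R by rewrite rD' /m /s; field.
have ye : y = ((1 + r) * s - m) / 2%:R.
  have yE : y = x - (u - v) by rewrite -Hy; ring.
  by rewrite rD' yE /m /s; field.
rewrite [leRHS](_ : _ = (E * (i ^+ 2 * m ^+ 2 + (M - r * i) ^+ 2 * s ^+ 2)
   + (D - E) * (M ^+ 2 * m ^+ 2 + (i - r * M) ^+ 2 * s ^+ 2)) / (2%:R * i)).
  have i2 : 0 <= 2%:R * i by rewrite mulr_ge0 // ltW.
  have DE : 0 <= D - E by rewrite subr_ge0.
  by rewrite divr_ge0 // addr_ge0 // mulr_ge0 // -!exprMn addr_ge0 ?sqr_ge0.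
clearbody r s m; rewrite ue ve xe ye.
have i0' : i != 0 by rewrite gt_eqF.
have M0' : M != 0 by rewrite gt_eqF.
by field; rewrite d0 Mi' i0' M0'.
Qed.

Lemma energy_le (j N : nat) (P V C : R) : (0 < j)%N -> (0 < N)%N ->
  `|P| <= C -> `|V| <= C -> energy j N P V <= 3%:R * C ^+ 2 / N%:R.
Proof.
move=> j0 N0 PC VC; have C0 : 0 <= C := le_trans (normr_ge0 _) PC.
have Nr : 0 < N%:R :> R by rewrite ltr0n.
have jr : 1 <= j%:R :> R by rewrite ler1n.
have P2 : P ^+ 2 <= C ^+ 2 by rewrite -real_normK ?num_real // lerXn2r ?nnegrE.
have PV : `|P * V| <= C ^+ 2 by rewrite normrM expr2 ler_pM.
have h1 : P ^+ 2 / (N.-1 + j)%:R ^+ 2 <= C ^+ 2 / N%:R.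
  rewrite ler_pM ?sqr_ge0 ?invr_ge0 ?sqr_ge0 //.
  rewrite lef_pV2 ?posrE // -?natrX ?ltr0n ?ler_nat ?expn_gt0; nia.
have alt M : (0 < M)%N -> 0 <= altsum M <= M%:R^-1.
  move=> M0; have := weight_ge0 M0; have := weight_rec M0.
  have : 0 <= weight M.+1 by exact: weight_ge0.
  have : 0 <= M.+1%:R^-1 :> R by rewrite invr_ge0.
  rewrite /altsum; move: (weight _) (weight _) (M%:R^-1 : R) (M.+1%:R^-1 : R) => a b c d.
  by move=> ????; apply/andP; split; lra.
have /andP[a0 a1] := alt N N0.
have Nj : (0 < N + j)%N by rewrite addn_gt0 N0.
have /andP[b0 b1] := alt _ Nj.
have bN : (N + j)%:R^-1 <= N%:R^-1 :> R by rewrite lef_pV2 ?posrE ?ltr0n ?ler_nat ?leq_addr.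
have h2 : 0 <= altsum N / (2%:R * j%:R) * (P ^+ 2 + V ^+ 2).
  apply: mulr_ge0; last by rewrite addr_ge0 ?sqr_ge0.
  by rewrite divr_ge0 // mulr_ge0 ?ler0n.
have h3 : `|(2%:R * altsum (N + j) - altsum N) / j%:R * (P * V)| <= 2%:R / N%:R * C ^+ 2.
  rewrite normrM ler_pM // normrM -[leRHS]mulr1 ler_pM //.
    by rewrite ler_norml; apply/andP; split; lra.
  by rewrite normfV ger0_norm ?invf_le1 // ?ltr0n // ler0n.
rewrite /energy.
move: h3; rewrite ler_norml => /andP[h3 _].
rewrite [leRHS](_ : _ = C ^+ 2 / N%:R + 2%:R / N%:R * C ^+ 2); last by ring.
by move: h1 h2 h3; move: (_ / _) (_ * (_ + _)) (_ * (P * V)) (C ^+ 2 / _) (_ * C ^+ 2) => *; lra.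
Qed.

Variable k : nat.
Hypothesis k_gt0 : (0 < k)%N.

Let G j n := energy j (n + k).+1 (wyang R k n j) (wyang R k n j.+1).

Lemma yang_energy_step n j : (0 < j <= n + k)%N ->
  0 <= yang R k n j ^+ 2 - yang R k n j.+1 ^+ 2 + G j n.+1 - G j n.
Proof.
move=> /andP[j0 jd].
have H1 := wyang_next R k_gt0 jd; have H2 := wyang_next_cross R k_gt0 jd.
rewrite /level in H1 H2.
have N0 : ((n + k).+1%:R - j%:R : R) != 0 by rewrite -natrB ?pnatr_eq0 ; lia.
have N1 : ((n + k).+1%:R + j%:R : R) != 0 by rewrite -natrD pnatr_eq0.
have e : (n + k + j.+1)%:R = (n + k).+1%:R + j%:R :> R by rewrite addnS -addSn natrD.
have := @energy_step j (n + k).+1 k%:R _ _ _ _ _ _ H2 H1.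
rewrite ![_ * (_ / _)]mulrC !divfK // !yang_wyang //= e.
by apply; [lia|rewrite ler0n ltr_nat ltnS leq_addl].
Qed.

(** For j <= k the start is n = 0, where [wyang_base] expresses P_(j+1) through P_j. For j > k all
    terms vanish by degree until n + k = j, where P_(j+1) is still 0 and P_j is not. Either way the
    form collapses to a positive combination of weights times P_j^2. *)
Lemma energy_start j : (0 < j)%N -> exists n0, [/\ (j <= n0 + k)%N,
  forall n, (n < n0)%N -> yang R k n j = 0 /\ yang R k n j.+1 = 0 & 0 < G j n0].
Proof.
move=> j0; have jr : 0 < j%:R :> R by rewrite ltr0n.
have jr0 : j%:R != 0 :> R by rewrite gt_eqF.
have sq_gt0 (x : R) : x != 0 -> 0 < x ^+ 2 by rewrite exprn_even_gt0.
have [jk|kj] := leqP j k.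
  exists 0%N; split => //; rewrite /G add0n /energy addSn !altsumS //; last by lia.
  have kj0 : (k + j)%:R != 0 :> R by rewrite pnatr_eq0; lia.
  have := wyang_base R jk; have := wyang_base_neq0 R k_gt0 jk.
  move: (wyang _ _ _ _) (wyang _ _ _ _) => V P P0 HV.
  have kr0 : k%:R != 0 :> R by rewrite pnatr_eq0; lia.
  have D0 : 0 < weight (k + j) by apply: weight_gt0; lia.
  have DE : weight (k + j) <= weight k by apply: weight_le; lia.
  rewrite natrD in kj0; have VE : V = - ((k%:R - j%:R) * P) / (k%:R + j%:R).
    by apply: (mulfI kj0); rewrite -(subr0 (_ * V)) -HV; field.
  rewrite VE /= natrD.
  rewrite [ltRHS](_ : _ = (P / (k%:R + j%:R)) ^+ 2 / j%:R *
    (k%:R ^+ 2 * (weight k - weight (k + j)) + j%:R ^+ 2 * weight (k + j))).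
    rewrite mulr_gt0 // ?divr_gt0 ?sq_gt0 // ?mulf_neq0 ?invr_eq0 //.
    by rewrite ltr_wpDl // ?mulr_gt0 ?mulr_ge0 ?sqr_ge0 ?sq_gt0 // subr_ge0.
  by field; rewrite kj0 jr0 kr0.
have nk : (j - k + k = j)%N by lia.
exists (j - k)%N; split; first by lia.
  by move=> n nj; rewrite !yang_wyang // !wyang_gt ?mul0r //; lia.
rewrite /G nk /energy /= altsumS // [wyang _ _ _ j.+1]wyang_gt ?nk //.
have := wyang_top_neq0 R k_gt0 (j - k); rewrite nk; move: (wyang _ _ _ _) => P P0.
rewrite natrD [ltRHS](_ : _ = P ^+ 2 * weight j / (4%:R * j%:R)); last first.
  by field; rewrite jr0 gt_eqF ?addr_gt0.
by apply: divr_gt0; apply: mulr_gt0; rewrite ?sq_gt0 ?weight_gt0 ?ltr0n.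
Qed.

(** Telescoping [yang_energy_step] from n0 to M leaves the gap G(n0) - G(M). The starting energy is
    d, and the uniform bound on P_j and P_(j+1) makes G(M) of order 1/M. *)
Lemma yang_sum_lt j : (0 < j)%N -> exists d C : R, exists n0, 0 < d /\
  forall M, (n0 <= M)%N ->
    \sum_(0 <= n < M) yang R k n j.+1 ^+ 2 + d <=
    \sum_(0 <= n < M) yang R k n j ^+ 2 + C / M.+1%:R.
Proof.
move=> j0; have [n0 [jn0 z0 G0]] := energy_start j0.
have [C1 HC1] := wyang_bounded R k_gt0 j; have [C2 HC2] := wyang_bounded R k_gt0 j.+1.
set C := Num.max C1 C2.
have C0 : 0 <= C by rewrite le_max (le_trans (normr_ge0 _) (HC1 _ jn0)).
exists (G j n0), (3%:R * C ^+ 2), n0.+1; split=> // M nM.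
have tele : G j n0 <= \sum_(n0 <= n < M) (yang R k n j ^+ 2 - yang R k n j.+1 ^+ 2) + G j M.
  have [m ->] : exists m, M = (n0 + m)%N by exists (M - n0)%N; lia.
  elim: m => [|m IH]; first by rewrite addn0 big_geq // add0r.
  rewrite addnS big_nat_recr ?leq_addr //= (le_trans IH) //.
  have := @yang_energy_step (n0 + m) j; rewrite j0 /=.
  move=> /(_ ltac:(lia)); set a := yang _ _ _ _ ^+ 2; set b := yang _ _ _ _ ^+ 2.
  by move: (G _ _) (G _ _) (\sum_(_ <= _ < _) _) => x y z; lra.
have GM : G j M <= 3%:R * C ^+ 2 / M.+1%:R.
  apply: (@le_trans _ _ (3%:R * C ^+ 2 / (M + k).+1%:R)).
    apply: energy_le => //; rewrite le_max.
      by rewrite HC1 //; lia.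
    by rewrite HC2 ?orbT //; lia.
  rewrite ler_wpM2l ?mulr_ge0 ?sqr_ge0 // lef_pV2 ?posrE ?ltr0n ?ler_nat //; lia.
have split i : (i == j) || (i == j.+1) ->
    \sum_(0 <= n < M) yang R k n i ^+ 2 = \sum_(n0 <= n < M) yang R k n i ^+ 2.
  move=> ij; rewrite (@big_cat_nat _ _ _ n0) //=; last by lia.
  rewrite big_nat big1 ?add0r // => n /andP[_ nn].
  by have [y1 y2] := z0 n nn; case/orP: ij => /eqP ->; rewrite ?y1 ?y2 expr0n.
rewrite !split ?eqxx ?orbT //.
move: tele; rewrite sumrB.
by move: GM; move: (G _ _) (G _ _) (\sum_(_ <= _ < _) _) (\sum_(_ <= _ < _) _) (_ / _) => *; lra.
Qed.

End Weight.

(** * Summation over all degrees *)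

Section YangSums.
Variables (R : realType) (k : nat).
Hypothesis k_gt0 : (0 < k)%N.

Definition yang_sum (j : nat) : \bar R := (\sum_(0 <= n <oo) (yang R k n j ^+ 2)%:E)%E.

Let sq_ge0 j n : (0 <= (yang R k n j ^+ 2)%:E)%E.
Proof. by rewrite lee_fin sqr_ge0. Qed.

Let inv_sq_ge0 n : (0 <= ((n%:R ^+ 2)^-1 : R)%:E)%E.
Proof. by rewrite lee_fin invr_ge0 sqr_ge0. Qed.

Lemma yang_sqr0 n : yang R k n 0 ^+ 2 = k%:R ^+ 2 * ((n + k)%:R ^+ 2)^-1.
Proof. by rewrite yang_wyang // wyang0 // addn0 expr_div_n. Qed.

Lemma yang_sqr1 n : yang R k n 1 ^+ 2 = k%:R ^+ 2 * ((n + k.+1)%:R ^+ 2)^-1.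
Proof. by rewrite yang_wyang // wyang1 // addn1 -addnS expr_div_n sqrrN. Qed.

Let tail_sum m : (\sum_(0 <= n <oo) (k%:R ^+ 2 * ((n + m)%:R ^+ 2)^-1)%:E =
  (k%:R ^+ 2)%:E * \sum_(m <= n <oo) ((n%:R ^+ 2)^-1 : R)%:E)%E.
Proof.
under eq_eseriesr do rewrite EFinM.
rewrite nneseriesZl //; congr (_ * _)%E.
exact: (@nneseries_addn R (fun n => ((n%:R ^+ 2)^-1)%:E) m).
Qed.

Lemma yang_sum0 : yang_sum 0 =
  ((k%:R ^+ 2)%:E * \sum_(k <= m <oo) ((m%:R ^+ 2)^-1)%:E)%E.
Proof. by rewrite /yang_sum; under eq_eseriesr do rewrite yang_sqr0; exact: tail_sum. Qed.

(** The terms are k^2 / (d + 1)^2 instead of k^2 / d^2, so the series only loses its first term, at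
    d = k, which is 1. *)
Lemma yang_sum1 : (yang_sum 1 = yang_sum 0 - 1)%E.
Proof.
have -> : yang_sum 1 = ((k%:R ^+ 2)%:E * \sum_(k.+1 <= m <oo) ((m%:R ^+ 2)^-1)%:E)%E.
  by rewrite /yang_sum; under eq_eseriesr do rewrite yang_sqr1; exact: tail_sum.
rewrite yang_sum0 (nneseries_split k 1) // addn1 big_nat1.
rewrite muleDr ?ge0_adde_def ?inE ?nneseries_ge0 // -EFinM divff; last first.
  by rewrite expf_neq0 // pnatr_eq0 -lt0n.
by rewrite [(1%:E + _)%E]addeC addeK.
Qed.

Let sum_inv_sqr_le m :
  \sum_(k <= n < m.+2) ((n%:R ^+ 2)^-1 : R) <= 2%:R - m.+1%:R^-1.
Proof.
have emp i : (i <= k)%N -> \sum_(k <= n < i) ((n%:R ^+ 2)^-1 : R) = 0 by move=> ik; rewrite big_geq.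
elim: m => [|m IH].
  have [k1|k1] := leqP k 1; last by rewrite emp // invr1 subr_ge0 ler1n.
  by rewrite big_nat_recr // emp //= expr1n invr1 add0r lerBrDr.
have [km|km] := leqP k m.+2; last first.
  by rewrite emp // subr_ge0 (@le_trans _ _ 1) ?invf_le1 ?ltr0n ?ler1n.
rewrite big_nat_recr //= (le_trans (lerD IH (lexx _))) //.
have e : m.+2%:R = m.+1%:R + 1 :> R by rewrite natr1.
have m0 : 0 < m.+1%:R :> R by [].
rewrite e; move: (m.+1%:R : R) m0 => x x0.
have x1 : 0 < x + 1 by rewrite addr_gt0.
rewrite -subr_ge0 [leRHS](_ : _ = (x * (x + 1) ^+ 2)^-1).
  by rewrite invr_ge0 mulr_ge0 ?sqr_ge0 // ltW.
by field; rewrite !gt_eqF.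
Qed.

Lemma yang_sum0_fin : (yang_sum 0 < +oo)%E.
Proof.
rewrite yang_sum0 lte_mul_pinfty ?lee_fin ?sqr_ge0 //.
apply: (@le_lt_trans _ _ 2%:R%:E); last by rewrite ltry.
apply: lime_le; first exact: is_cvg_nneseries.
near=> M; have [m ->] : exists m, M = m.+2.
  exists M.-2; have : (1 < M)%N by near: M; exact: nbhs_infty_gt.
  lia.
by rewrite sumEFin lee_fin (@le_trans _ _ (2%:R - m.+1%:R^-1)) ?gerBl ?invr_ge0.
Unshelve. all: by end_near. Qed.

Lemma yang_sum_decr j : (yang_sum j.+1 < yang_sum j)%E.
Proof.
(* Finiteness is carried through the induction: the strict inequality at j hands it to j + 1. The
   case j = 0 is [yang_sum1], as the energy argument requires j > 0. *)
suff [fin step] : (yang_sum j < +oo)%E /\ (yang_sum j.+1 < yang_sum j)%E by [].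
have ge0 i : (0 <= yang_sum i)%E by exact: nneseries_ge0.
have fnum i : (yang_sum i < +oo)%E -> yang_sum i \is a fin_num.
  by move=> ioo; rewrite ge0_fin_numE.
elim: j => [|j [fin step]].
  split; first exact: yang_sum0_fin.
  by rewrite yang_sum1 lteBlDr // lteDl ?fnum ?yang_sum0_fin.
have fin1 := lt_trans step fin; split=> //.
have [d [C [n0 [d0 H]]]] := yang_sum_lt R k_gt0 (ltn0Sn j).
have s1E := fineK (fnum _ fin1); set s := fine _ in s1E.
(* Beyond M0 the error C / (M + 1) is at most d / 2, so half of the gap d survives in the limit. *)
have [M0 HM0] : exists M0 : nat, `|C| * (2%:R / d) < M0%:R.
  by exists (Num.bound (`|C| * (2%:R / d))); apply: archi_boundP; rewrite mulr_ge0 ?divr_ge0 // ltW.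
apply: (@le_lt_trans _ _ (s - d / 2%:R)%:E); last first.
  by rewrite -s1E lte_fin gtrBl divr_gt0.
have combine (x y z t : R) : z <= t / 2%:R -> y <= s -> x + t <= y + z -> x <= s - t / 2%:R by lra.
apply: lime_le; first exact: is_cvg_nneseries.
near=> M; rewrite sumEFin lee_fin.
have n0M : (n0 <= M)%N by near: M; exact: nbhs_infty_ge.
have M0M : (M0 <= M)%N by near: M; exact: nbhs_infty_ge.
apply: combine (H M n0M).
  rewrite ler_pdivrMr // (le_trans (ler_norm _)) //.
  rewrite -ler_pdivrMl ?divr_gt0 // invf_div mulrC (le_trans (ltW HM0)) // ler_nat.
  exact: leqW.
by rewrite -lee_fin s1E -sumEFin; apply: nneseries_lim_ge.
Unshelve. all: by end_near. Qed.

End YangSums.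

(** * Reduction of the defect spaces to the extremal polynomials *)

Section Hardy.
Variable R : realType.
Implicit Types (f g : series2 R) (d e : nat).
Local Notation C := R[i].

Lemma sqr_normc_conj (z : C) : ((Normc.normc z ^+ 2)%:C)%C = z * z^*.
Proof. by rewrite rmorphXn /= -normCK; case: z. Qed.

Lemma normc_nneg (z : C) : 0 <= Normc.normc z.
Proof. by case: z => x y; exact: sqrtr_ge0. Qed.

Lemma sum_antidiag d N (F : nat -> nat -> C) : (d < N)%N ->
  (forall a b, (a + b)%N != d -> F a b = 0) ->
  \sum_(a < N) \sum_(b < N) F a b = \sum_(a < d.+1) F a (d - a)%N.
Proof.
move=> dN F0; rewrite [RHS](big_ord_widen_cond N xpredT (fun a => F a (d - a)%N)) //=.
rewrite [RHS]big_mkcond /=; apply: eq_bigr => a _.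
case: ifPn => [ad|]; last first.
  by rewrite -leqNgt => da; apply: big1 => b _; apply: F0; lia.
have db : (d - a < N)%N by lia.
rewrite (bigD1 (Ordinal db)) //= big1 ?addr0 // => b; rewrite -val_eqE /= => bd.
by apply: F0; lia.
Qed.

Lemma inner2_homogeneous d f g : homogeneous2 d f ->
  inner2 f g = \sum_(a < d.+1) f (a : nat, (d - a)%N) * (g (a : nat, (d - a)%N))^*.
Proof.
move=> fd; rewrite /inner2; apply: (@lim_near_cst (C^o : ptopologicalType)); first exact: norm_hausdorff.
near=> N; apply: (@sum_antidiag d N (fun a b => f (a, b) * (g (a, b))^*)).
  by near: N; exact: nbhs_infty_gt.
by move=> a b ab; rewrite fd // mul0r.
Unshelve. all: by end_near. Qed.

Lemma hardy2_homogeneous d f : homogeneous2 d f -> hardy2 f.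
Proof.
move=> fd; rewrite /hardy2 /= /normsq2.
pose S := [set i : nat * nat | (i.1 + i.2)%N = d].
have finS : finite_set S.
  apply: (@sub_finite_set _ _ [set i : nat * nat | (i.1 < d.+1)%N /\ (i.2 < d.+1)%N]).
    by move=> [a b] /= <-; rewrite !ltnS leq_addr leq_addl.
  exact: (finite_setX (finite_II d.+1) (finite_II d.+1)).
rewrite (_ : \esum_(i in _) _ = \esum_(i in S) (Normc.normc (f i) ^+ 2)%:E); last first.
  rewrite [RHS]esum_mkcond; apply: eq_esum => -[a b] _; case: ifPn => //.
  rewrite notin_setE /= => /eqP ab; rewrite fd // Normc.normc0 expr0n //.
rewrite esum_fset // => [|i _]; last by rewrite lee_fin sqr_ge0.
by rewrite fsbig_finite //= sumEFin ltry.
Qed.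

Lemma normsq2_coef f (e : R) i : 0 < e ->
  (normsq2 f < (e ^+ 2)%:E)%E -> Normc.normc (f i) < e.
Proof.
move=> e0 fe; have : ((Normc.normc (f i) ^+ 2)%:E < (e ^+ 2)%:E)%E.
  apply: le_lt_trans fe; apply: esum_ge; exists [set i].
    by split=> //; exact: finite_set1.
  by rewrite fsbig_set1.
by rewrite lte_fin ltr_pXn2r // nnegrE ?normc_nneg // ltW.
Qed.

(** * Homogeneous components as polynomials in one variable *)

Definition antidiag d f : {poly C} := \poly_(a < d.+1) f (a, (d - a)%N).

Lemma coef_antidiag d f a : (a <= d)%N -> (antidiag d f)`_a = f (a, (d - a)%N).
Proof. by move=> ad; rewrite coef_poly ltnS ad. Qed.

Lemma of_poly2_mulzBw (p : {poly {poly C}}) a b :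
  of_poly2 ((zvar R - wvar R) * p) (a, b) =
  (if a is a'.+1 then of_poly2 p (a', b) else 0) -
  (if b is b'.+1 then of_poly2 p (a, b') else 0).
Proof.
rewrite /of_poly2 /= /zvar /wvar mulrBl !coefB coefXM coefCM coefXM.
by case: a => [|a] /=; case: b => [|b] //=; rewrite coef0.
Qed.

Lemma homogeneous2_mulzBw k n (p : {poly {poly C}}) : homogeneous2 n (of_poly2 p) ->
  homogeneous2 (n + k) (of_poly2 ((zvar R - wvar R) ^+ k * p)).
Proof.
move=> hp; elim: k => [|k IH]; first by rewrite expr0 mul1r addn0.
move=> a b ab; rewrite exprS -mulrA of_poly2_mulzBw.
by case: a b ab => [|a] [|b] ab; rewrite ?IH ?subrr //; lia.
Qed.

(** Here z - w becomes X - 1, whereas the Szego pair starts from 1 - X; [map_1subX_exp] reconciles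
    the signs. *)
Lemma antidiag_mulzBw k n (p : {poly {poly C}}) :
  antidiag (n + k) (of_poly2 ((zvar R - wvar R) ^+ k * p)) =
  ('X - 1) ^+ k * antidiag n (of_poly2 p).
Proof.
elim: k => [|k IH]; first by rewrite !expr0 !mul1r addn0.
rewrite exprS -mulrA [in RHS]exprS -mulrA -IH addnS.
apply/polyP => a; rewrite [in RHS]mulrBl mul1r coefB coefXM !coef_poly of_poly2_mulzBw.
case: a => [|a] /=; first by rewrite subn0.
rewrite !ltnS subSS; case: (ltngtP a (n + k)) => h.
- by rewrite -[(n + k - a)%N]prednK ?subn_gt0 //= ; congr (_ - of_poly2 _ (_, _)); lia.
- by rewrite subrr.
- by rewrite h subnn.
Qed.

Definition homog2 n (q : {poly C}) : {poly {poly C}} :=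
  \poly_(a < n.+1) (q`_a *: 'X^(n - a)).

Lemma of_poly2_homog2 n (q : {poly C}) a b :
  of_poly2 (homog2 n q) (a, b) = if (a + b == n)%N then q`_a else 0.
Proof.
rewrite /of_poly2 /= coef_poly; case: (ltnP a n.+1) => an; last first.
  by rewrite coef0; case: eqP => // e; lia.
rewrite coefZ coefXn (_ : (b == n - a) = (a + b == n))%N; last by lia.
by case: eqP; rewrite ?mulr1 ?mulr0.
Qed.

Lemma homogeneous2_homog2 n (q : {poly C}) : homogeneous2 n (of_poly2 (homog2 n q)).
Proof. by move=> a b ab; rewrite of_poly2_homog2 (negPf ab). Qed.

Lemma antidiag_homog2 n (q : {poly C}) : (size q <= n.+1)%N -> antidiag n (of_poly2 (homog2 n q)) = q.
Proof.
move=> sq; apply/polyP => a; rewrite coef_poly of_poly2_homog2.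
case: ifPn => an; first by rewrite subnKC // eqxx.
by rewrite nth_default // (leq_trans sq) // leqNgt.
Qed.

Variable k : nat.

Lemma Mk_mulzBw n (q : {poly C}) :
  Mk R k (of_poly2 ((zvar R - wvar R) ^+ k * homog2 n q)).
Proof.
split; first by apply: hardy2_homogeneous; apply: homogeneous2_mulzBw; exact: homogeneous2_homog2.
move=> e e0; exists (of_poly2 ((zvar R - wvar R) ^+ k * homog2 n q)); first by exists (homog2 n q).
rewrite /normsq2 esum1 ?lte_fin ?exprn_gt0 // => i _.
by rewrite /sub2 subrr Normc.normc0 expr0n.
Qed.

(** Divisibility survives the closure: the remainder modulo (X - 1)^k depends linearly on finitely
    many coefficients of f, hence continuously on f, and it vanishes on polynomial multiples of (z -
    w)^k. *)
Lemma Mk_antidiag_dvd n f : Mk R k f -> exists q, antidiag (n + k) f = ('X - 1) ^+ k * q.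
Proof.
move=> [_ Hf]; set D := ('X - 1) ^+ k; pose d := (n + k)%N.
suff E : antidiag d f %% D = 0.
  by exists (antidiag d f %/ D); rewrite mulrC {1}(divp_eq (antidiag d f) D) E addr0.
apply/polyP => i; rewrite coef0; apply: (@Normc.eq0_normc R).
pose K := \sum_(a < d.+1) Normc.normc (('X^a %% D : {poly C})`_i).
have K0 : 0 <= K by apply: sumr_ge0 => a _; exact: normc_nneg.
apply/eqP; rewrite eq_le normc_nneg andbT; apply/ler_addgt0Pl => e e0; rewrite addr0.
(* K bounds the i-th coefficient of the remainder per unit of coefficient error; adding 1 guards
   against K = 0. *)
have e'0 : 0 < e / (K + 1) by rewrite divr_gt0 // ltr_wpDl.
have [g [q _ <-] fg] := Hf _ e'0.
have gD : antidiag d (of_poly2 ((zvar R - wvar R) ^+ k * q)) %% D = 0.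
  by rewrite antidiag_mulzBw modp_mulr.
set g' := of_poly2 _ in fg gD.
have -> : antidiag d f %% D = antidiag d (sub2 f g') %% D.
  have -> : antidiag d (sub2 f g') = antidiag d f - antidiag d g'.
    apply/polyP => a; rewrite coefB !coef_poly; case: ifP => _ //; by rewrite subr0.
  by rewrite modpD modpN gD subr0.
have -> : antidiag d (sub2 f g') %% D =
    \sum_(a < d.+1) (sub2 f g' (a : nat, (d - a)%N)) *: ('X^a %% D).
  rewrite /antidiag poly_def.
  elim/big_rec2: _ => [|a x y _ <-]; first by rewrite mod0p.
  by rewrite modpD modpZl.
rewrite coef_sum (le_trans (y := \sum_(a < d.+1) e / (K + 1) * Normc.normc (('X^a %% D : {poly C})`_i))) //.
  elim/big_rec2: _ => [|a x y _ xy]; first by rewrite Normc.normc0.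
  rewrite (le_trans (le_normcD _ _)) // lerD // coefZ Normc.normcM ler_wpM2r ?normc_nneg //.
  exact: ltW (normsq2_coef _ e'0 fg).
rewrite -mulr_sumr -/K mulrAC ler_pdivrMr ?ltr_wpDl // ler_wpM2l ?ltW //.
by rewrite ltrDl.
Qed.

(** * The defect spaces in each degree *)

Hypothesis k_gt0 : (0 < k)%N.
Local Notation toC p := (map_poly (real_complex R) p).

Lemma size_Xsub1_expM (q : {poly C}) : q != 0 ->
  size (('X - 1) ^+ k * q)%R = (k + size q)%N.
Proof.
move=> q0; rewrite -polyC1 size_mul ?expf_neq0 ?polyXsubC_eq0 //.
by rewrite size_exp_XsubC.
Qed.

Lemma map_1subX_exp : toC ((1 - 'X) ^+ k) = (-1) ^+ k * ('X - 1) ^+ k.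
Proof.
by rewrite rmorphXn rmorphB rmorph1 /= map_polyX -exprMn mulN1r opprB.
Qed.

Lemma Xsub1_expM_coef0 (p q : {poly C}) : p = ('X - 1) ^+ k * q -> p`_0 = 0 ->
  exists r, q = r * 'X.
Proof.
move=> pE p0; exists (drop_poly 1 q); rewrite -[LHS](poly_take_drop 1) expr1.
  rewrite [take_poly _ _](_ : _ = 0) ?add0r //; apply/polyP => i.
  rewrite coef_take_poly coef0; case: ifP => // ; case: i => // _.
  apply/eqP; move/eqP: p0; rewrite pE coef0M mulf_eq0 -horner_coef0 horner_exp.
  by rewrite expf_eq0 -polyC1 hornerXsubC sub0r oppr_eq0 oner_eq0 andbF.
Qed.

(** By reversal the sum is, up to sign, the coefficient of X^(n+k) in p psi_n. Writing p = (X - 1)^k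
    X r with deg r < n, it involves only coefficients k to n + k - 1 of (1 - X)^k psi_n, which is
    the gap of [szego_gap]. *)
Lemma sphi_orth n (p q : {poly C}) : p = ('X - 1) ^+ k * q ->
  (size p <= (n + k).+1)%N -> p`_0 = 0 ->
  \sum_(a < (n + k).+1) ((sphi R k n)`_a)%:C%C * p`_a = 0.
Proof.
move=> pE sp p0.
have [r qE] := Xsub1_expM_coef0 pE p0.
have [r0|r0] := eqVneq r 0.
  by apply: big1 => a _; rewrite pE qE r0 mul0r mulr0 coef0 mulr0.
have sr : (size r <= n)%N.
  move: sp; rewrite pE size_Xsub1_expM ?qE ?mulf_neq0 ?polyX_eq0 // size_mulX //; lia.
transitivity ((-1) ^+ k * (p * toC (spsi R k n))`_(n + k)).
  rewrite coefM mulr_sumr; apply: eq_bigr => -[a /= ad] _.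
  rewrite coef_map spsi_rev /=; last by lia.
  rewrite subKn // rmorphM rmorphXn rmorphN1 /=; move: (_ %:C%C) => x.
  rewrite [RHS](_ : _ = ((-1) ^+ k * (-1) ^+ k) * (x * p`_a)); last by ring.
  by rewrite -expr2 sqrr_sign mul1r.
rewrite pE qE.
have -> : ('X - 1) ^+ k * (r * 'X) * toC (spsi R k n) =
    (-1) ^+ k * ('X * (r * toC ((1 - 'X) ^+ k * spsi R k n))).
  rewrite rmorphM /= map_1subX_exp.
  rewrite [RHS](_ : _ = ((-1) ^+ k * (-1) ^+ k) * (('X - 1) ^+ k * (r * 'X) * toC (spsi R k n))); last by ring.
  by rewrite -expr2 sqrr_sign mul1r.
rewrite (_ : (-1) ^+ k = ((-1) ^+ k)%:P :> {poly C}); last by rewrite rmorphXn rmorphN1.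
rewrite coefCM coefXM; case: eqP => [|_]; first by rewrite !mulr0.
rewrite coefM big1 ?mulr0 // => -[i /= id] _; rewrite coef_map.
have [ni|ni] := leqP n i; first by rewrite nth_default ?mul0r // (leq_trans sr).
by rewrite (szego_gap R k n).2 ?rmorph0 ?mulr0 //; lia.
Qed.

Lemma spsi_orth n (p q : {poly C}) : p = ('X - 1) ^+ k * q ->
  (size p <= n + k)%N ->
  \sum_(a < (n + k).+1) ((spsi R k n)`_a)%:C%C * p`_a = 0.
Proof.
move=> pE sp.
have [q0|q0] := eqVneq q 0.
  by apply: big1 => a _; rewrite pE q0 mulr0 coef0 mulr0.
have sq : (size q <= n)%N by move: sp; rewrite pE size_Xsub1_expM //; lia.
transitivity ((-1) ^+ k * (p * toC (sphi R k n))`_(n + k)).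
  rewrite coefM mulr_sumr; apply: eq_bigr => -[a /= ad] _.
  rewrite coef_map spsi_rev /=; last by lia.
  by rewrite rmorphM rmorphXn rmorphN1 -mulrA [X in _ * X]mulrC.
have -> : p * toC (sphi R k n) = (-1) ^+ k * (q * toC ((1 - 'X) ^+ k * sphi R k n)).
  rewrite pE rmorphM /= map_1subX_exp.
  rewrite [RHS](_ : _ = ((-1) ^+ k * (-1) ^+ k) * (('X - 1) ^+ k * q * toC (sphi R k n))); last by ring.
  by rewrite -expr2 sqrr_sign mul1r.
rewrite (_ : (-1) ^+ k = ((-1) ^+ k)%:P :> {poly C}); last by rewrite rmorphXn rmorphN1.
rewrite coefCM coefM big1 ?mulr0 // => -[i /= id] _; rewrite coef_map.
have [ni|ni] := leqP n i; first by rewrite nth_default ?mul0r // (leq_trans sq).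
by rewrite (szego_gap R k n).1 ?rmorph0 ?mulr0 //; lia.
Qed.

(** One-dimensionality: [antidiag d f] and s are both orthogonal to the multiples of (X - 1)^k whose
    coefficient at [a0] is 0. Subtracting the right multiple of s gives such a polynomial p, which
    is then orthogonal to itself. *)
Lemma antidiag_line d f (s t : {poly C}) a0 :
  (exists q, antidiag d f = ('X - 1) ^+ k * q) ->
  s = ('X - 1) ^+ k * t -> (size s <= d.+1)%N -> s`_a0 != 0 ->
  (forall p q : {poly C}, p = ('X - 1) ^+ k * q -> (size p <= d.+1)%N -> p`_a0 = 0 ->
     \sum_(a < d.+1) f (a : nat, (d - a)%N) * (p`_a)^* = 0 /\
     \sum_(a < d.+1) s`_a * (p`_a)^* = 0) ->
  exists c : C, antidiag d f = c *: s.
Proof.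
move=> [q fE] sE ss s0 H; set c := (antidiag d f)`_a0 / s`_a0; exists c.
pose p := antidiag d f - c *: s.
have pE : p = ('X - 1) ^+ k * (q - c *: t) by rewrite /p fE sE mulrBr scalerAr.
have sp : (size p <= d.+1)%N.
  rewrite (leq_trans (size_polyD _ _)) // geq_max size_poly size_polyN.
  by rewrite (leq_trans (size_scale_leq _ _)).
have p0 : p`_a0 = 0 by rewrite coefB coefZ divfK // subrr.
have [H1 H2] := H p _ pE sp p0.
have : \sum_(a < d.+1) p`_a * (p`_a)^* = 0.
  transitivity (\sum_(a < d.+1) f (a : nat, (d - a)%N) * (p`_a)^*
      - c * \sum_(a < d.+1) s`_a * (p`_a)^*); last by rewrite H1 H2 mulr0 subr0.
  rewrite mulr_sumr -sumrB; apply: eq_bigr => -[a /= ad] _.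
  by rewrite {1}/p coefB coefZ coef_antidiag // mulrBl mulrA.
move/psumr_eq0P => Hp; apply/eqP; rewrite -subr_eq0; apply/eqP/polyP => a.
rewrite coef0; have [ad|ad] := ltnP a d.+1; last by rewrite nth_default // (leq_trans sp).
apply/eqP; rewrite -mul_conjC_eq0; apply/eqP.
by apply: (Hp _ (Ordinal ad)) => // i _; exact: mul_conjC_ge0.
Qed.

Lemma conj_real_sum d (s : {poly R}) (p : {poly C}) :
  \sum_(a < d) (s`_a)%:C%C * p`_a = 0 ->
  \sum_(a < d) (toC s)`_a * (p`_a)^* = 0.
Proof.
move/(congr1 Num.conj); rewrite conjC0 rmorph_sum => H; apply: (etrans _ H); apply: eq_bigr => a _.
rewrite rmorphM coef_map /=; congr (_ * _); apply/esym/CrealP.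
by apply/complex_realP; exists s`_a.
Qed.

Lemma map_Xsub1_dvd (s q : {poly R}) : s = (1 - 'X) ^+ k * q ->
  toC s = ('X - 1) ^+ k * ((-1) ^+ k * toC q).
Proof. by move=> ->; rewrite rmorphM /= map_1subX_exp; ring. Qed.

Lemma size_toC (s : {poly R}) : size (toC s) = size s.
Proof. by rewrite size_map_inj_poly // => x y []. Qed.

Lemma sum_mulz_eq0 n f (p q : {poly C}) : homogeneous2 (n + k) f ->
  defect_z (Mk R k) f -> p = ('X - 1) ^+ k * q -> (size p <= (n + k).+1)%N -> p`_0 = 0 ->
  \sum_(a < (n + k).+1) f (a : nat, (n + k - a)%N) * (p`_a)^* = 0.
Proof.
move=> fd [_ fM] pE sp p0; have [r qE] := Xsub1_expM_coef0 pE p0.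
have [r0|r0] := eqVneq r 0.
  by apply: big1 => a _; rewrite pE qE r0 mul0r mulr0 coef0 conjC0 mulr0.
have sr : (size r <= n)%N.
  move: sp; rewrite pE size_Xsub1_expM ?qE ?mulf_neq0 ?polyX_eq0 // size_mulX //; lia.
have [m nE] : exists m, n = m.+1.
  by exists n.-1; move: r0; rewrite -size_poly_gt0; lia.
(* p = X (X - 1)^k r is the antidiagonal of z h, with h in M one degree lower. *)
pose h := of_poly2 ((zvar R - wvar R) ^+ k * homog2 m r).
have hE : antidiag (m + k) h = ('X - 1) ^+ k * r.
  by rewrite antidiag_mulzBw antidiag_homog2 // -nE.
have /fM : (mulz (R := R) @` Mk R k) (mulz h) by exists h => //; exact: Mk_mulzBw.
rewrite (inner2_homogeneous _ fd) => H; apply: (etrans _ H); apply: eq_bigr => -[a /= ad] _.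
congr (_ * _^*); rewrite /mulz /=; case: a ad => // a ad.
have -> : (n + k - a.+1 = m + k - a)%N by rewrite nE.
rewrite -coef_antidiag ?hE; last by lia.
by rewrite pE qE mulrA coefMX.
Qed.

Lemma sum_mulw_eq0 n f (p q : {poly C}) : homogeneous2 (n + k) f ->
  defect_w (Mk R k) f -> p = ('X - 1) ^+ k * q -> (size p <= n + k)%N ->
  \sum_(a < (n + k).+1) f (a : nat, (n + k - a)%N) * (p`_a)^* = 0.
Proof.
move=> fd [_ fM] pE sp.
have [q0|q0] := eqVneq q 0.
  by apply: big1 => a _; rewrite pE q0 mulr0 coef0 conjC0 mulr0.
have sq : (size q <= n)%N by move: sp; rewrite pE size_Xsub1_expM //; lia.
have [m nE] : exists m, n = m.+1.
  by exists n.-1; move: q0; rewrite -size_poly_gt0; lia.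
(* Since p has no term X^(n+k), it is the antidiagonal of w h, where multiplication by w leaves the
   power of X unchanged. *)
pose h := of_poly2 ((zvar R - wvar R) ^+ k * homog2 m q).
have hE : antidiag (m + k) h = p.
  by rewrite antidiag_mulzBw antidiag_homog2 // -nE.
have /fM : (mulw (R := R) @` Mk R k) (mulw h) by exists h => //; exact: Mk_mulzBw.
rewrite (inner2_homogeneous _ fd) => H; apply: (etrans _ H); apply: eq_bigr => -[a /= ad] _.
congr (_ * _^*); rewrite /mulw /=.
have [e|[b e]] : (n + k - a = 0)%N \/ exists b, (n + k - a = b.+1)%N.
- by case: (n + k - a)%N => [|b]; [left|right; exists b].
- by rewrite e nth_default // (leq_trans sp) // -subn_eq0 e.
rewrite e (_ : b = m + k - a)%N; last by lia.
by rewrite -coef_antidiag ?hE //; lia.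
Qed.

Lemma defect_z_line n f : homogeneous2 (n + k) f -> defect_z (Mk R k) f ->
  exists c : C, antidiag (n + k) f = c *: toC (sphi R k n).
Proof.
move=> fd fM; have [[t tE] _] := szego_dvd R k n.
apply: (@antidiag_line _ _ _ _ 0%N _ (map_Xsub1_dvd tE)).
- exact: Mk_antidiag_dvd fM.1.
- by rewrite size_toC (szego_size R k n).1.
- by rewrite coef_map sphi_coef0 fmorph_eq0 oner_eq0.
move=> p q pE sp p0; split; first exact: sum_mulz_eq0 pE sp p0.
by apply: conj_real_sum; exact: sphi_orth pE sp p0.
Qed.

Lemma defect_w_line n f : homogeneous2 (n + k) f -> defect_w (Mk R k) f ->
  exists c : C, antidiag (n + k) f = c *: toC (spsi R k n).
Proof.
move=> fd fM; have [_ [t tE]] := szego_dvd R k n.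
(* The distinguished coefficient is now that of z^(n+k), the only monomial of this degree not
   divisible by w. *)
apply: (@antidiag_line _ _ _ _ (n + k)%N _ (map_Xsub1_dvd tE)).
- exact: Mk_antidiag_dvd fM.1.
- by rewrite size_toC (szego_size R k n).2.
- rewrite coef_map spsi_rev // subnn sphi_coef0 mulr1 fmorph_eq0 signr_eq0 //.
move=> p q pE sp p0.
have {}sp : (size p <= n + k)%N.
  move: sp; rewrite leq_eqVlt => /orP[/eqP sp|//].
  by move/eqP: p0; rewrite -[(n + k)%N]/((n + k).+1.-1) -sp -lead_coefE lead_coef_eq0 => /eqP ->; rewrite size_poly0.
split; first exact: sum_mulw_eq0 pE sp.
by apply: conj_real_sum; exact: spsi_orth pE sp.
Qed.

(** * Evaluation of the shifted pairings *)

Lemma iter_mulw j f a b :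
  iter j (@mulw R) f (a, b) = if (j <= b)%N then f (a, (b - j)%N) else 0.
Proof.
elim: j b => [|j IH] b /=; first by rewrite subn0.
by rewrite {1}/mulw /=; case: b => [|b] //; rewrite IH ltnS subSS.
Qed.

Lemma iter_mulz j f a b :
  iter j (@mulz R) f (a, b) = if (j <= a)%N then f ((a - j)%N, b) else 0.
Proof.
elim: j a => [|j IH] a /=; first by rewrite subn0.
by rewrite {1}/mulz /=; case: a => [|a] //; rewrite IH ltnS subSS.
Qed.

Lemma sqnorm_line n f (c : C) (s : {poly R}) : homogeneous2 (n + k) f ->
  antidiag (n + k) f = c *: toC s ->
  inner2 f f = 1 ->
  Normc.normc c ^+ 2 * \sum_(a < (n + k).+1) s`_a ^+ 2 = 1.
Proof.
move=> fd fE f1; apply: (@complexI R); rewrite rmorphM /= sqr_normc_conj rmorph1 -f1.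
rewrite (inner2_homogeneous _ fd) rmorph_sum mulr_sumr; apply: eq_bigr => -[a /= ad] _.
rewrite -coef_antidiag // fE coefZ coef_map /= rmorphM /= rmorphM /=.
rewrite (_ : ((s`_a)%:C%C)^* = (s`_a)%:C%C); last first.
  by apply/CrealP/complex_realP; exists s`_a.
by rewrite mulrACA.
Qed.

Lemma sqnorm_spsi n : \sum_(a < (n + k).+1) (spsi R k n)`_a ^+ 2 = sqnorm R k n.
Proof.
rewrite /sqnorm [RHS](reindex_inj rev_ord_inj) /=; apply: eq_bigr => -[a /= ad] _.
by rewrite spsi_rev // exprMn sqrr_sign mul1r subSS.
Qed.

Lemma normc_inner2_shift n f g j : homogeneous2 (n + k) f -> homogeneous2 (n + k) g ->
  defect_z (Mk R k) f -> defect_w (Mk R k) g -> inner2 f f = 1 -> inner2 g g = 1 ->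
  Normc.normc (inner2 (iter j (@mulw R) f) (iter j (@mulz R) g)) ^+ 2 = yang R k n j ^+ 2.
Proof.
move=> fd gd fM gM f1 g1.
have [c fE] := defect_z_line fd fM; have [c' gE] := defect_w_line gd gM.
have Nc := sqnorm_line fd fE f1; have := sqnorm_line gd gE g1; rewrite sqnorm_spsi => Nc'.
rewrite -/(sqnorm R k n) in Nc.
have hd : homogeneous2 (n + k + j) (iter j (@mulw R) f).
  by move=> a b ab; rewrite iter_mulw; case: ifP => // jb; apply: fd; lia.
have -> : inner2 (iter j (@mulw R) f) (iter j (@mulz R) g) =
    c * c'^* * ((-1) ^+ k * cA R k n (n + k + j))%:C%C.
  rewrite (inner2_homogeneous _ hd) -cA_corr rmorph_sum mulr_sumr.
  have C0 : (0 : R)%:C%C = 0 by [].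
  apply: eq_bigr => -[a /= ad] _; rewrite iter_mulw iter_mulz.
  case: (leqP j a) => ja; last by rewrite conjC0 !mulr0.
  (* Where w^j phi_n has no term, a exceeds n + k and the coefficient of [sphi] is 0 as well. *)
  case: leqP => jb; last by rewrite (@sphi_coef_gt _ _ n a) ?mul0r ?C0 ?mulr0 //; lia.
  have -> : (n + k + j - a - j = n + k - a)%N by lia.
  have -> : (n + k + j - a = n + k - (a - j))%N by lia.
  rewrite -!coef_antidiag; [|lia..].
  rewrite fE gE !coefZ !coef_map /= !rmorphM /=.
  rewrite (_ : (((spsi R k n)`_(a - j))%:C%C)^* = ((spsi R k n)`_(a - j))%:C%C); last first.
    by apply/CrealP/complex_realP; exists (spsi R k n)`_(a - j).
  by rewrite mulrACA.
have nJ : Normc.normc c'^* = Normc.normc c' by case: (c') => x y /=; rewrite sqrrN.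
have nR (x : R) : Normc.normc x%:C%C ^+ 2 = x ^+ 2.
  by rewrite /= expr0n addr0 sqr_sqrtr ?sqr_ge0.
rewrite /yang !Normc.normcM !exprMn nJ nR exprMn sqrr_sign mul1r.
have S0 := sqnorm_gt0 R k n.
have E (x : R) : x ^+ 2 * sqnorm R k n = 1 -> x ^+ 2 = (sqnorm R k n)^-1.
  by move=> e; rewrite -[RHS]mul1r -e mulfK // gt_eqF.
(* Unit norm fixes only the moduli of c and c'; the squared modulus of each is the inverse of
   [sqnorm], so the unimodular constants disappear. *)
rewrite (E _ Nc) (E _ Nc') cB_top exprVn exprMn sqrr_sign mul1r.
by rewrite mulrC expr2 [_ ^+ 2]expr2 invfM.
Qed.

End Hardy.

Theorem theorem1p1 (R : realType) (k : nat) (hk : (1 <= k)%N)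
    (phi psi : nat -> series2 R)
    (hphi : homogeneous_onb k (defect_z (Mk R k)) phi)
    (hpsi : homogeneous_onb k (defect_w (Mk R k)) psi) :
  [/\ Sigma phi psi 0 =
        ((k%:R ^+ 2)%:E * \sum_(k <= m <oo) ((m%:R ^+ 2)^-1)%:E)%E,
      Sigma phi psi 1 = (Sigma phi psi 0 - 1)%E,
      forall j : nat, (Sigma phi psi j.+1 < Sigma phi psi j)%E
    & decreasing_seq (Sigma phi psi)].
Proof.
have [phiM phid phi1 _] := hphi; have [psiM psid psi1 _] := hpsi.
have E j : Sigma phi psi j = yang_sum R k j.
  apply: eq_eseriesr => n _; congr (_%:E).
  by apply: normc_inner2_shift => //; rewrite ?phi1 ?psi1 eqxx.
have decr j : (Sigma phi psi j.+1 < Sigma phi psi j)%E by rewrite !E yang_sum_decr.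
rewrite !E yang_sum1 // yang_sum0 //; split=> //.
exact/decreasing_seqP.
Qed.
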